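(* Let $K$ be a field of characteristic $0$, $m\ge2$, and let $\widehat{F_m}$ be the completion, with respect to the formal power series topology, of the free metabelian Lie algebra $F_m$ over $K$ with free generators $y_1,\dots,y_m$. Let $\Theta$ be the set of continuous automorphisms $\theta$ of $\widehat{F_m}$ with Jacobian matrix of the form \[ J(\theta)=I_m+\left(\begin{array}{llll} s(t_2,\ldots,t_m)&f_{12}&\cdots&f_{1m}\\ t_1q_2(t_2,t_3,\ldots,t_m)+r_2(t_2,\ldots,t_m)&f_{22}&\cdots&f_{2m}\\ t_1q_3(t_3,\ldots,t_m)+r_3(t_2,\ldots,t_m)&f_{32}&\cdots&f_{3m}\\ \quad\vdots&\ \vdots&\ddots&\ \vdots\\ t_1q_m(t_m)+r_m(t_2,\ldots,t_m)&f_{m2}&\cdots&f_{mm} \end{array}\right), \] where $s,q_i,r_i,f_{ij}\in K[[t_1,\dots,t_m]]$ are formal power series without constant terms satisfying \[ s+\sum_{i=2}^mt_iq_i=0,\qquad \sum_{i=2}^mt_ir_i=0,\qquad \sum_{i=1}^mt_if_{ij}=0,\quad j=2,\dots,m, \] such that $s=s(t_2,\dots,t_m)$ and $r_i=r_i(t_2,\dots,t_m)$, $i=2,\dots,m$, do not depend on $t_1$; $q_i=q_i(t_i,\dots,t_m)$, $i=2,\dots,m$, does not depend on $t_1,\dots,t_{i-1}$; and $f_{12}$ does not contain a summand $dt_2$ with $0\neq d\in K$ (i.e. the coefficient of the monomial $t_2$ in $f_{12}$ is zero). Then $\Theta$ consists of coset representatives of the subgroup $\mathrm{Inn}(\widehat{F_m})$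 of the group $\mathrm{IA}(\widehat{F_m})$, and $\mathrm{IOut}(\widehat{F_m})=\mathrm{IA}(\widehat{F_m})/\mathrm{Inn}(\widehat{F_m})$ is the disjoint union of the cosets $\mathrm{Inn}(\widehat{F_m})\theta$, $\theta\in\Theta$ (i.e. every coset of $\mathrm{Inn}(\widehat{F_m})$ in $\mathrm{IA}(\widehat{F_m})$ contains exactly one element of $\Theta$).
   Context: $L_m$ is the free Lie algebra over $K$ on $x_1,\dots,x_m$, and $F_m=L_m/L_m''$ has free generators $y_i=x_i+L_m''$. $F_m$ is graded by total degree in the $y_i$, and $\widehat{F_m}$ (the completion for the topology with basis of open sets $r+F_m^k$, where $F_m^k$ is the $k$-th lower central term) consists of formal infinite sums $f_1+f_2+\cdots$ with $f_k$ homogeneous of degree $k$; $\widehat{F_m'}$ is its commutator ideal (series with $f_1=0$). $\mathrm{IA}(\widehat{F_m})$ is the group of continuous automorphisms of $\widehat{F_m}$ that induce the identity modulo $\widehat{F_m'}$. With $u(\mathrm{ad}\,v)=[u,v]$, $\mathrm{Inn}(\widehat{F_m})$ is the normal subgroup of $\mathrm{IA}(\widehat{F_m})$ consisting of the inner automorphisms $\exp(\mathrm{ad}\,u)=\sum_{k\ge0}(\mathrm{ad}\,u)^k/k!$, $u\in\widehat{F_m}$. Partial derivatives. Let $A_m,B_m$ be abelian Lie algebras with bases $a_1,\dots,a_m$ and $b_1,\dots,b_m$. Let $C_m=\bigoplus_{i=1}^m a_iK[t_1,\dots,t_m]$ be the free right $K[t_1,\dots,t_m]$-module on $a_1,\dots,a_m$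 with trivial Lie bracket. The abelian wreath product is the semidirect sum of $C_m$ and $B_m$ with $[C_m,C_m]=[B_m,B_m]=0$ and $[a_if,b_j]=a_i f t_j$. The homomorphism $\varepsilon$ of $F_m$ into it given by $\varepsilon(y_i)=a_i+b_i$ is injective, and it extends to the completions, with $\widehat{C_m}=\bigoplus_i a_iK[[t_1,\dots,t_m]]$ in place of $C_m$. If $\varepsilon(f)=\sum_i\beta_ib_i+\sum_ia_if_i(t_1,\dots,t_m)$ with $\beta_i\in K$, then $\partial f/\partial y_i:=f_i$. The Jacobian matrix of an endomorphism $\phi$ is $J(\phi)=\left(\partial\phi(y_j)/\partial y_i\right)\in M_m(K[[t_1,\dots,t_m]])$, with $i$ the row index and $j$ the column index. $I_m$ is the identity matrix. *)

(* Defs.v *)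
From HB Require Import structures.
From mathcomp Require Import all_boot all_order all_algebra ring_quotient.
From mathcomp Require Import boolp classical_sets functions.
From mathcomp Require Import mpoly.
From mathcomp Require Import ring.

Set Implicit Arguments.
Unset Strict Implicit.
Unset Printing Implicit Defensive.

Import GRing.Theory.
Local Open Scope ring_scope.
Local Open Scope quotient_scope.
Local Open Scope classical_set_scope.

HB.mixin Record Lmodule_isLie (K : fieldType) (L : Type)
    of GRing.Lmodule K L := {
  lie : L -> L -> L;
  lieDl : forall x y z, lie (x + y) z = lie x z + lie y z;
  lieZl : forall (a : K) x y, lie (a *: x) y = a *: lie x y;
  lieDr : forall x y z, lie x (y + z) = lie x y + lie x z;
  lieZr : forall (a : K) x y, lie x (a *: y) = a *: lie x y;
  liexx : forall x, lie x x = 0;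
  lie_jacobi : forall x y z,
    lie x (lie y z) + lie y (lie z x) + lie z (lie x y) = 0
}.

#[short(type="lieAlgType")]
HB.structure Definition LieAlgebra (K : fieldType) :=
  {L of GRing.Lmodule K L & Lmodule_isLie K L}.

Reserved Notation "[lie x , y ]" (format "[lie  x ,  y ]").
Notation "[lie x , y ]" := (lie x y) : ring_scope.

Section LieTheory.
Variables (K : fieldType) (L : lieAlgType K).
Implicit Types x y z : L.

Lemma lie0x x : [lie 0, x] = 0.
Proof. by rewrite -(scale0r (0 : L)) lieZl !scale0r. Qed.

Lemma liex0 x : [lie x, 0] = 0.
Proof. by rewrite -(scale0r (0 : L)) lieZr !scale0r. Qed.

Lemma lieNx x y : [lie - x, y] = - [lie x, y].
Proof. by rewrite -scaleN1r lieZl scaleN1r. Qed.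

Lemma liexN x y : [lie x, - y] = - [lie x, y].
Proof. by rewrite -scaleN1r lieZr scaleN1r. Qed.

Lemma lieC x y : [lie x, y] = - [lie y, x].
Proof.
have := liexx (x + y); rewrite lieDl !lieDr !liexx add0r addr0.
by move/eqP; rewrite addr_eq0 => /eqP.
Qed.

Lemma lie_suml I (r : seq I) (P : pred I) (F : I -> L) y :
  [lie \sum_(i <- r | P i) F i, y] = \sum_(i <- r | P i) [lie F i, y].
Proof. by apply: (big_morph (fun x => [lie x, y])) => [u v|]; rewrite ?lieDl ?lie0x. Qed.

Lemma lie_sumr I (r : seq I) (P : pred I) (F : I -> L) x :
  [lie x, \sum_(i <- r | P i) F i] = \sum_(i <- r | P i) [lie x, F i].
Proof. by apply: (big_morph (fun y => [lie x, y])) => [u v|]; rewrite ?lieDr ?liex0. Qed.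

(* [U, V]: the linear span of all brackets of an element of U and one of V. *)
Inductive lie_span (U V : set L) : set L :=
  | lie_span0 : lie_span U V 0
  | lie_spanP a u v x : U u -> V v -> lie_span U V x ->
      lie_span U V (a *: [lie u, v] + x).

Lemma lie_spanD U V x y : lie_span U V x -> lie_span U V y -> lie_span U V (x + y).
Proof.
by elim=> [|a u v z Uu Vv _ IH] sy; rewrite ?add0r // -addrA; apply: lie_spanP => //; apply: IH.
Qed.

Lemma lie_spanZ U V a x : lie_span U V x -> lie_span U V (a *: x).
Proof.
elim=> [|b u v z Uu Vv _ IH]; first by rewrite scaler0; apply: lie_span0.
by rewrite scalerDr scalerA; apply: lie_spanP.
Qed.

Lemma lie_span_br (U V : set L) u v : U u -> V v -> lie_span U V [lie u, v].
Proof.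
by move=> Uu Vv; rewrite -[[lie u, v]]scale1r -[_ *: _]addr0; apply: lie_spanP => //; apply: lie_span0.
Qed.

(* L' = [L, L] and L'' = [L', L'] *)
Definition derived1 : set L := lie_span setT setT.
Definition derived2 : set L := lie_span derived1 derived1.

Lemma derived2_lie x y : derived2 x -> derived2 [lie x, y].
Proof.
elim=> [|a u v z d1u d1v _ IH]; first by rewrite lie0x; apply: lie_span0.
rewrite lieDl lieZl; apply: lie_spanD => //; apply: lie_spanZ.
have -> : [lie [lie u, v], y] = [lie u, [lie v, y]] + [lie v, [lie y, u]].
  rewrite lieC; apply/eqP; rewrite eq_sym -addr_eq0 ?opprK; apply/eqP.
  exact: lie_jacobi.
apply: lie_spanD; apply: lie_span_br => //; exact: lie_span_br.
Qed.

Definition derived2b : {pred L} := fun x => `[< derived2 x >].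

Lemma derived2b_submod : submod_closed derived2b.
Proof.
split=> [|a x y]; rewrite !unfold_in.
  by apply/asboolP; apply: lie_span0.
move=> /asboolP dx /asboolP dy; apply/asboolP.
by apply: lie_spanD => //; apply: lie_spanZ.
Qed.

HB.instance Definition _ := GRing.isSubmodClosed.Build K L derived2b derived2b_submod.

End LieTheory.

Definition lie_morphism (K : fieldType) (L M : lieAlgType K) (phi : L -> M) :=
  linear phi /\ {morph phi : x y / [lie x, y]}.

Section FreeLie.
Variables (K : fieldType) (m : nat).

(* Terms over 'I_m in the language of K-Lie algebras, and the least
   congruence containing the axioms of K-Lie algebras. *)
Inductive lterm :=
  | LVar of 'I_m
  | LZero
  | LAdd of lterm & lterm
  | LScale of K & lterm
  | LBr of lterm & lterm.

Inductive leqv : lterm -> lterm -> Prop :=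
  | leqv_refl x : leqv x x
  | leqv_sym x y : leqv x y -> leqv y x
  | leqv_trans x y z : leqv x y -> leqv y z -> leqv x z
  | leqv_add x x' y y' : leqv x x' -> leqv y y' -> leqv (LAdd x y) (LAdd x' y')
  | leqv_scale a x x' : leqv x x' -> leqv (LScale a x) (LScale a x')
  | leqv_br x x' y y' : leqv x x' -> leqv y y' -> leqv (LBr x y) (LBr x' y')
  | leqv_addA x y z : leqv (LAdd x (LAdd y z)) (LAdd (LAdd x y) z)
  | leqv_addC x y : leqv (LAdd x y) (LAdd y x)
  | leqv_add0 x : leqv (LAdd LZero x) x
  | leqv_addN x : leqv (LAdd (LScale (-1) x) x) LZero
  | leqv_scaleA a b x : leqv (LScale a (LScale b x)) (LScale (a * b) x)
  | leqv_scale1 x : leqv (LScale 1 x) x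
  | leqv_scaleDr a x y : leqv (LScale a (LAdd x y)) (LAdd (LScale a x) (LScale a y))
  | leqv_scaleDl a b x : leqv (LScale (a + b) x) (LAdd (LScale a x) (LScale b x))
  | leqv_brDl x y z : leqv (LBr (LAdd x y) z) (LAdd (LBr x z) (LBr y z))
  | leqv_brZl a x y : leqv (LBr (LScale a x) y) (LScale a (LBr x y))
  | leqv_brDr x y z : leqv (LBr x (LAdd y z)) (LAdd (LBr x y) (LBr x z))
  | leqv_brZr a x y : leqv (LBr x (LScale a y)) (LScale a (LBr x y))
  | leqv_brxx x : leqv (LBr x x) LZero
  | leqv_jacobi x y z :
      leqv (LAdd (LAdd (LBr x (LBr y z)) (LBr y (LBr z x))) (LBr z (LBr x y))) LZero.

HB.instance Definition _ := gen_eqMixin lterm.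
HB.instance Definition _ := gen_choiceMixin lterm.

Definition leqvb : rel lterm := fun x y => `[< leqv x y >].

Lemma leqvb_equiv : equiv_class_of leqvb.
Proof.
split=> [x|x y|y x z]; first by apply/asboolP; apply: leqv_refl.
  by apply/asboolP/asboolP; apply: leqv_sym.
by move=> /asboolP xy /asboolP yz; apply/asboolP; apply: leqv_trans yz.
Qed.

Canonical leqvb_equivRel := EquivRelPack leqvb_equiv.
Canonical leqvb_encModRel := defaultEncModRel leqvb.

(* the free Lie algebra L_m on x_1, ..., x_m *)
Definition FreeLie := {eq_quot leqvb}.
HB.instance Definition _ : EqQuotient lterm leqvb FreeLie := EqQuotient.on FreeLie.
HB.instance Definition _ := Choice.on FreeLie.

Local Notation pi x := (\pi_FreeLie x).

Lemma piLP x y : reflect (pi x = pi y) `[< leqv x y >].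
Proof. by apply: (iffP idP) => [h|/eqP]; [apply/eqP; rewrite piE|rewrite piE]. Qed.

Lemma piL x y : leqv x y -> pi x = pi y.
Proof. by move=> h; apply/piLP/asboolP. Qed.

Lemma reprL x : leqv (repr (pi x)) x.
Proof. by apply/asboolP/piLP; rewrite reprK. Qed.

Definition FL_zero : FreeLie := pi LZero.
Definition FL_add : FreeLie -> FreeLie -> FreeLie :=
  locked (fun x y => pi (LAdd (repr x) (repr y))).
Definition FL_scale : K -> FreeLie -> FreeLie :=
  locked (fun a x => pi (LScale a (repr x))).
Definition FL_opp (x : FreeLie) : FreeLie := FL_scale (-1) x.
Definition FL_br : FreeLie -> FreeLie -> FreeLie :=
  locked (fun x y => pi (LBr (repr x) (repr y))).

Lemma FL_addE x y : FL_add (pi x) (pi y) = pi (LAdd x y).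
Proof. by rewrite /FL_add -lock; apply: piL; apply: leqv_add; apply: reprL. Qed.
Lemma FL_scaleE a x : FL_scale a (pi x) = pi (LScale a x).
Proof. by rewrite /FL_scale -lock; apply: piL; apply: leqv_scale; apply: reprL. Qed.
Lemma FL_brE x y : FL_br (pi x) (pi y) = pi (LBr x y).
Proof. by rewrite /FL_br -lock; apply: piL; apply: leqv_br; apply: reprL. Qed.

Let FLE := (FL_addE, FL_scaleE, FL_brE).

Lemma FL_addA : associative FL_add.
Proof. by elim/quotW=> x; elim/quotW=> y; elim/quotW=> z; rewrite !FLE; (apply: piL; apply: leqv_addA). Qed.
Lemma FL_addC : commutative FL_add.
Proof. by elim/quotW=> x; elim/quotW=> y; rewrite !FLE; (apply: piL; apply: leqv_addC). Qed.
Lemma FL_add0 : left_id FL_zero FL_add.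
Proof. by elim/quotW=> x; rewrite !FLE; (apply: piL; apply: leqv_add0). Qed.
Lemma FL_addN : left_inverse FL_zero FL_opp FL_add.
Proof. by elim/quotW=> x; rewrite /FL_opp !FLE; (apply: piL; apply: leqv_addN). Qed.

HB.instance Definition _ :=
  GRing.isZmodule.Build FreeLie FL_addA FL_addC FL_add0 FL_addN.

Lemma piLD x y : pi (LAdd x y) = pi x + pi y.
Proof. by rewrite -FL_addE. Qed.

Lemma FL_scaleA a b x : FL_scale a (FL_scale b x) = FL_scale (a * b) x.
Proof. by elim/quotW: x => x; rewrite !FLE; (apply: piL; apply: leqv_scaleA). Qed.
Lemma FL_scale1 : left_id 1 FL_scale.
Proof. by elim/quotW=> x; rewrite !FLE; (apply: piL; apply: leqv_scale1). Qed.
Lemma FL_scaleDr : right_distributive FL_scale +%R.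
Proof.
by move=> a; elim/quotW=> x; elim/quotW=> y; rewrite -piLD !FLE -piLD; (apply: piL; apply: leqv_scaleDr).
Qed.
Lemma FL_scaleDl x : {morph FL_scale^~ x : a b / a + b}.
Proof. by move=> a b; elim/quotW: x => x; rewrite !FLE -piLD; (apply: piL; apply: leqv_scaleDl). Qed.

HB.instance Definition _ :=
  GRing.Zmodule_isLmodule.Build K FreeLie FL_scaleA FL_scale1 FL_scaleDr FL_scaleDl.

Lemma piLZ a x : pi (LScale a x) = a *: pi x.
Proof. by rewrite -FL_scaleE. Qed.

Lemma FL_brDl x y z : FL_br (x + y) z = FL_br x z + FL_br y z.
Proof.
elim/quotW: x => x; elim/quotW: y => y; elim/quotW: z => z.
by rewrite -piLD !FLE -piLD; (apply: piL; apply: leqv_brDl).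
Qed.
Lemma FL_brZl a x y : FL_br (a *: x) y = a *: FL_br x y.
Proof. by elim/quotW: x => x; elim/quotW: y => y; rewrite -piLZ !FLE -piLZ; (apply: piL; apply: leqv_brZl). Qed.
Lemma FL_brDr x y z : FL_br x (y + z) = FL_br x y + FL_br x z.
Proof.
elim/quotW: x => x; elim/quotW: y => y; elim/quotW: z => z.
by rewrite -piLD !FLE -piLD; (apply: piL; apply: leqv_brDr).
Qed.
Lemma FL_brZr a x y : FL_br x (a *: y) = a *: FL_br x y.
Proof. by elim/quotW: x => x; elim/quotW: y => y; rewrite -piLZ !FLE -piLZ; (apply: piL; apply: leqv_brZr). Qed.
Lemma FL_brxx x : FL_br x x = 0.
Proof. by elim/quotW: x => x; rewrite !FLE; (apply: piL; apply: leqv_brxx). Qed.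
Lemma FL_jacobi x y z : FL_br x (FL_br y z) + FL_br y (FL_br z x) + FL_br z (FL_br x y) = 0.
Proof.
elim/quotW: x => x; elim/quotW: y => y; elim/quotW: z => z.
by rewrite !FLE -!piLD; (apply: piL; apply: leqv_jacobi).
Qed.

HB.instance Definition _ := Lmodule_isLie.Build K FreeLie
  FL_brDl FL_brZl FL_brDr FL_brZr FL_brxx FL_jacobi.

Lemma piLB x y : pi (LBr x y) = [lie pi x, pi y].
Proof. by rewrite -FL_brE. Qed.

Definition flie_gen (i : 'I_m) : FreeLie := pi (LVar i).

Section Lift.
Variables (G : lieAlgType K) (g : 'I_m -> G).

Fixpoint leval (x : lterm) : G :=
  match x with
  | LVar i => g i
  | LZero => 0
  | LAdd x y => leval x + leval y
  | LScale a x => a *: leval x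
  | LBr x y => [lie leval x, leval y]
  end.

Lemma leval_leqv x y : leqv x y -> leval x = leval y.
Proof.
elim=> //= {x y}.
- by move=> x y z _ -> _ ->.
- by move=> x x' y y' _ -> _ ->.
- by move=> a x x' _ ->.
- by move=> x x' y y' _ -> _ ->.
- by move=> x y z; rewrite addrA.
- by move=> x y; rewrite addrC.
- by move=> x; rewrite add0r.
- by move=> x; rewrite scaleN1r addNr.
- by move=> a b x; rewrite scalerA.
- by move=> x; rewrite scale1r.
- by move=> a x y; rewrite scalerDr.
- by move=> a b x; rewrite scalerDl.
- by move=> x y z; rewrite lieDl.
- by move=> a x y; rewrite lieZl.
- by move=> x y z; rewrite lieDr.
- by move=> a x y; rewrite lieZr.
- by move=> x; rewrite liexx.
- by move=> x y z; rewrite lie_jacobi.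
Qed.

(* the homomorphism L_m -> G with x_i |-> g i *)
Definition flie_lift (x : FreeLie) : G := leval (repr x).

Lemma flie_liftE x : flie_lift (pi x) = leval x.
Proof. exact/leval_leqv/reprL. Qed.

Lemma flie_lift_gen i : flie_lift (flie_gen i) = g i.
Proof. exact: flie_liftE. Qed.

Lemma flie_lift_morphism : lie_morphism flie_lift.
Proof.
split=> [a|]; elim/quotW=> x; elim/quotW=> y.
  by rewrite -piLZ -piLD !flie_liftE.
by rewrite -piLB !flie_liftE.
Qed.

End Lift.
End FreeLie.

Section FreeMetabelian.
Variables (K : fieldType) (m : nat).
Local Notation L := (FreeLie K m).

(* F_m = L_m / L_m'' *)
Definition FreeMetab := Quotient.quot (@derived2b K L : zmodClosed L).
HB.instance Definition _ := GRing.Zmodule.on FreeMetab.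
HB.instance Definition _ : EqQuotient L (Quotient.equiv (@derived2b K L : zmodClosed L)) FreeMetab :=
  EqQuotient.on FreeMetab.

Local Notation pi x := (\pi_FreeMetab x).

Lemma piFP (x y : L) : (pi x = pi y) <-> derived2 (x - y).
Proof.
split=> [/eqP|h].
  by rewrite -[_ == _]/(_ == _ %[mod FreeMetab]) -Quotient.idealrBE => /asboolP.
by apply/eqP; rewrite -[_ == _]/(_ == _ %[mod FreeMetab]) -Quotient.idealrBE; apply/asboolP.
Qed.

Lemma reprF (x : L) : derived2 (repr (pi x) - x).
Proof. by apply/piFP; rewrite reprK. Qed.

Lemma piFD (x y : L) : pi (x + y) = pi x + pi y.
Proof. by rewrite -[RHS]/(Quotient.add _ _) /Quotient.add; unlock; apply/piFP;
  rewrite opprD addrACA; apply: lie_spanD; apply/piFP; rewrite reprK. Qed.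

Definition FM_scale : K -> FreeMetab -> FreeMetab :=
  locked (fun a x => pi (a *: repr x)).
Definition FM_br : FreeMetab -> FreeMetab -> FreeMetab :=
  locked (fun x y => pi [lie repr x, repr y]).

Lemma FM_scaleE a x : FM_scale a (pi x) = pi (a *: x).
Proof. by rewrite /FM_scale -lock; apply/piFP; rewrite -scalerBr; apply/lie_spanZ/reprF. Qed.

Lemma FM_brE x y : FM_br (pi x) (pi y) = pi [lie x, y].
Proof.
rewrite /FM_br -lock; apply/piFP.
have -> : [lie repr (pi x), repr (pi y)] - [lie x, y] =
    [lie repr (pi x) - x, repr (pi y)] - [lie repr (pi y) - y, x].
  by rewrite !(lieDl, lieNx) (lieC x y) (lieC x (repr _)) !opprD !opprK addrA addrK.
rewrite -scaleN1r; apply: lie_spanD; last apply: lie_spanZ.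
  exact/derived2_lie/reprF.
exact/derived2_lie/reprF.
Qed.

Lemma FM_scaleA a b x : FM_scale a (FM_scale b x) = FM_scale (a * b) x.
Proof. by elim/quotW: x => x; rewrite !FM_scaleE scalerA. Qed.
Lemma FM_scale1 : left_id 1 FM_scale.
Proof. by elim/quotW=> x; rewrite !FM_scaleE scale1r. Qed.
Lemma FM_scaleDr : right_distributive FM_scale +%R.
Proof.
by move=> a; elim/quotW=> x; elim/quotW=> y; rewrite -piFD !FM_scaleE scalerDr piFD.
Qed.
Lemma FM_scaleDl x : {morph FM_scale^~ x : a b / a + b}.
Proof. by move=> a b; elim/quotW: x => x; rewrite !FM_scaleE scalerDl piFD. Qed.

HB.instance Definition _ :=
  GRing.Zmodule_isLmodule.Build K FreeMetab FM_scaleA FM_scale1 FM_scaleDr FM_scaleDl.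

Lemma piFZ a (x : L) : pi (a *: x) = a *: pi x.
Proof. by rewrite -FM_scaleE. Qed.

Lemma piF0 : pi 0 = 0.
Proof. by rewrite -(scale0r (0 : L)) piFZ scale0r. Qed.

Lemma FM_brDl x y z : FM_br (x + y) z = FM_br x z + FM_br y z.
Proof.
elim/quotW: x => x; elim/quotW: y => y; elim/quotW: z => z.
by rewrite -piFD !FM_brE lieDl piFD.
Qed.
Lemma FM_brZl a x y : FM_br (a *: x) y = a *: FM_br x y.
Proof. by elim/quotW: x => x; elim/quotW: y => y; rewrite -piFZ !FM_brE lieZl piFZ. Qed.
Lemma FM_brDr x y z : FM_br x (y + z) = FM_br x y + FM_br x z.
Proof.
elim/quotW: x => x; elim/quotW: y => y; elim/quotW: z => z.
by rewrite -piFD !FM_brE lieDr piFD.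
Qed.
Lemma FM_brZr a x y : FM_br x (a *: y) = a *: FM_br x y.
Proof. by elim/quotW: x => x; elim/quotW: y => y; rewrite -piFZ !FM_brE lieZr piFZ. Qed.
Lemma FM_brxx x : FM_br x x = 0.
Proof. by elim/quotW: x => x; rewrite !FM_brE liexx piF0. Qed.
Lemma FM_jacobi x y z : FM_br x (FM_br y z) + FM_br y (FM_br z x) + FM_br z (FM_br x y) = 0.
Proof.
elim/quotW: x => x; elim/quotW: y => y; elim/quotW: z => z.
by rewrite !FM_brE -!piFD lie_jacobi piF0.
Qed.

HB.instance Definition _ := Lmodule_isLie.Build K FreeMetab
  FM_brDl FM_brZl FM_brDr FM_brZr FM_brxx FM_jacobi.

Lemma piFB (x y : L) : pi [lie x, y] = [lie pi x, pi y].
Proof. by rewrite -FM_brE. Qed.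

(* y_i = x_i + L_m'' *)
Definition fmet_gen (i : 'I_m) : FreeMetab := pi (flie_gen K i).

Section Lift.
Variables (G : lieAlgType K) (g : 'I_m -> G).
Hypothesis metabG : forall a b c d : G, [lie [lie a, b], [lie c, d]] = 0.

(* the homomorphism F_m -> G with y_i |-> g i, for G metabelian *)
Definition fmet_lift (x : FreeMetab) : G := flie_lift g (repr x).

Let phi := flie_lift g.
Let phiD x y : phi (x + y) = phi x + phi y.
Proof. by have := (flie_lift_morphism g).1 1 x y; rewrite !scale1r. Qed.
Let phi0 : phi 0 = 0.
Proof. by apply: (addrI (phi 0)); rewrite -phiD !addr0. Qed.
Let phiZ a x : phi (a *: x) = a *: phi x.
Proof. by have := (flie_lift_morphism g).1 a x 0; rewrite -/phi phi0 !addr0. Qed.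
Let phiB x y : phi [lie x, y] = [lie phi x, phi y].
Proof. exact: (flie_lift_morphism g).2. Qed.

Let phi_d1 u z : derived1 u -> (forall c d : G, [lie [lie c, d], z] = 0) ->
  [lie phi u, z] = 0.
Proof.
move=> du hz; elim: du => [|a x y w _ _ _ IH]; first by rewrite phi0 lie0x.
by rewrite phiD phiZ phiB lieDl lieZl hz scaler0 add0r.
Qed.

Lemma flie_lift_derived2 u : derived2 u -> flie_lift g u = 0.
Proof.
rewrite -/phi; elim=> [|a x y w dx dy _ IH]; first exact: phi0.
rewrite phiD phiZ phiB IH addr0 phi_d1 ?scaler0 // => c d.
by rewrite lieC phi_d1 ?oppr0.
Qed.

Lemma fmet_liftE x : fmet_lift (pi x) = flie_lift g x.
Proof.
have := flie_lift_derived2 (reprF x).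
rewrite -/phi -scaleN1r phiD phiZ scaleN1r => /eqP.
by rewrite subr_eq0 => /eqP.
Qed.

Lemma fmet_lift_gen i : fmet_lift (fmet_gen i) = g i.
Proof. by rewrite fmet_liftE flie_lift_gen. Qed.

Lemma fmet_lift_morphism : lie_morphism fmet_lift.
Proof.
split=> [a|]; elim/quotW=> x; elim/quotW=> y.
  by rewrite -piFZ -piFD !fmet_liftE -/phi phiD phiZ.
by rewrite -piFB !fmet_liftE -/phi phiB.
Qed.

End Lift.

(* the homogeneous component of F_m of total degree k in the y_i *)
Inductive homogF : nat -> set FreeMetab :=
  | homogF_gen i : homogF 1 (fmet_gen i)
  | homogF_br j k x y : homogF j x -> homogF k y -> homogF (j + k) [lie x, y]
  | homogF0 k : homogF k 0
  | homogF_lin k (a : K) x y : homogF k x -> homogF k y -> homogF k (a *: x + y).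

Lemma homogF_sum I (r : seq I) (P : pred I) (f : I -> FreeMetab) k :
  (forall i, P i -> homogF k (f i)) -> homogF k (\sum_(i <- r | P i) f i).
Proof.
move=> h; apply: big_ind => //; first exact: homogF0.
by move=> x y hx hy; rewrite -[x]scale1r; apply: homogF_lin.
Qed.

Lemma homogF_deg0 x : homogF 0 x -> x = 0.
Proof.
suff h k y : homogF k y -> k = 0%N -> y = 0 by move=> /h; apply.
elim=> //= {k y} [[|j] [|l] // u v _ /(_ erefl)-> _ _ _|l a u v _ IHu _ IHv e].
  by rewrite lie0x.
by rewrite IHu // IHv // scaler0 addr0.
Qed.

Definition homog_series : pred (nat -> FreeMetab) :=
  fun f => `[< forall k, homogF k (f k) >].

Lemma homog_series_submod : submod_closed homog_series.
Proof.
split=> [|a f g]; rewrite !unfold_in.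
  by apply/asboolP => k; apply: homogF0.
by move=> /asboolP hf /asboolP hg; apply/asboolP => k; apply: homogF_lin.
Qed.

HB.instance Definition _ :=
  GRing.isSubmodClosed.Build K (nat -> FreeMetab) homog_series homog_series_submod.

(* The completion of F_m: a formal sum f_1 + f_2 + ... is encoded by its
   sequence of homogeneous components; the component of degree 0 is 0 by
   homogF_deg0. *)
Record hatF := HatF { hcomp :> nat -> FreeMetab; _ : homog_series hcomp }.

HB.instance Definition _ := [isSub for hcomp].
HB.instance Definition _ := [Choice of hatF by <:].
HB.instance Definition _ := [SubChoice_isSubLmodule of hatF by <:].

Definition mk_hatF f (hf : forall k, homogF k (f k)) : hatF :=
  @HatF f (introT (asboolP _) hf).

Lemma hatF_homog (f : hatF) k : homogF k (f k).
Proof. by case: f => f /= /asboolP. Qed.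

Lemma hatFP (f g : hatF) : (forall k, f k = g k) -> f = g.
Proof. by move=> h; apply/val_inj/funext. Qed.

Lemma hcompD (f g : hatF) k : (f + g) k = f k + g k. Proof. by []. Qed.
Lemma hcompZ (a : K) (f : hatF) k : (a *: f) k = a *: f k. Proof. by []. Qed.
Lemma hcomp0 k : (0 : hatF) k = 0. Proof. by []. Qed.
Lemma hcompN (f : hatF) k : (- f) k = - f k. Proof. by []. Qed.
Lemma hcomp_sum I (r : seq I) (P : pred I) (f : I -> hatF) k :
  (\sum_(i <- r | P i) f i) k = \sum_(i <- r | P i) f i k.
Proof. by apply: (big_morph (fun f : hatF => f k)). Qed.

Lemma hbr_subproof (f g : hatF) n : homogF n (\sum_(i < n.+1) [lie f i, g (n - i)%N]).
Proof.
apply: homogF_sum => i _; rewrite -{1}(subnKC (leq_ord i)).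
by apply: homogF_br; apply: hatF_homog.
Qed.

Definition hbr (f g : hatF) : hatF := mk_hatF (hbr_subproof f g).

Lemma hbrE (f g : hatF) N n : (n <= N)%N -> hbr f g n =
  \sum_(i < N.+1) \sum_(j < N.+1 | (i + j == n)%N) [lie f i, g j].
Proof.
move=> nN; rewrite /= (big_ord_widen N.+1 (fun i => [lie f i, g (n - i)%N])) ?ltnS //.
rewrite big_mkcond; apply: eq_bigr => i _; rewrite ltnS; case: leqP => [in_|ni]; last first.
  by rewrite big1 // => j /eqP e; move: ni; rewrite -e ltnNge leq_addr.
have hj : (n - i < N.+1)%N by rewrite ltnS (leq_trans (leq_subr _ _)).
rewrite (big_pred1 (Ordinal hj)) // => j /=.
by rewrite -val_eqE /= -[RHS](eqn_add2l i) subnKC.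
Qed.

Lemma hbr3E (f g h : hatF) n : hbr f (hbr g h) n =
  \sum_(i < n.+1) \sum_(j < n.+1) \sum_(k < n.+1 | (i + j + k == n)%N) [lie f i, [lie g j, h k]].
Proof.
rewrite (hbrE _ _ (leqnn n)); apply: eq_bigr => i _.
under eq_bigr => l _ do rewrite (hbrE _ _ (leq_ord l)) lie_sumr.
rewrite exchange_big /=; apply: eq_bigr => j _.
under eq_bigr => l _ do rewrite lie_sumr.
rewrite (exchange_big_dep xpredT) //= [RHS]big_mkcond; apply: eq_bigr => k _.
case: eqP => [e|ne]; last first.
  by rewrite big1 // => l /andP[/eqP e1 /eqP e2]; case: ne; rewrite -addnA e2.
have hl : (j + k < n.+1)%N by have := leq_addl i (j + k)%N; rewrite addnA e.
rewrite (big_pred1 (Ordinal hl)) // => l /=; rewrite -val_eqE /= [RHS]eq_sym.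
case: (j + k =P l)%N => [el|]; rewrite ?andbF ?andbT //.
by rewrite -el addnA e eqxx.
Qed.

Lemma hbrDl x y z : hbr (x + y) z = hbr x z + hbr y z.
Proof.
by apply: hatFP => n; rewrite hcompD /= -big_split; apply: eq_bigr => i _; apply: lieDl.
Qed.
Lemma hbrZl a x y : hbr (a *: x) y = a *: hbr x y.
Proof.
by apply: hatFP => n; rewrite hcompZ /= scaler_sumr; apply: eq_bigr => i _; apply: lieZl.
Qed.
Lemma hbrDr x y z : hbr x (y + z) = hbr x y + hbr x z.
Proof.
by apply: hatFP => n; rewrite hcompD /= -big_split; apply: eq_bigr => i _; apply: lieDr.
Qed.
Lemma hbrZr a x y : hbr x (a *: y) = a *: hbr x y.
Proof.
by apply: hatFP => n; rewrite hcompZ /= scaler_sumr; apply: eq_bigr => i _; apply: lieZr.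
Qed.
Lemma hbrxx x : hbr x x = 0.
Proof.
apply: hatFP => n; rewrite hcomp0 (hbrE _ _ (leqnn n)) pair_big_dep /=.
rewrite (bigID (fun p : 'I_n.+1 * 'I_n.+1 => p.1 < p.2)%N) /=.
rewrite [X in _ + X](bigID (fun p : 'I_n.+1 * 'I_n.+1 => p.1 == p.2)) /=.
rewrite [X in _ + (X + _)]big1 ?add0r; last first.
  by move=> [i j] /= /andP[_ /eqP->]; rewrite liexx.
rewrite [X in X + _](reindex_inj (h := fun p => (p.2, p.1))) /=; last first.
  by move=> [a b] [c d] /= [-> ->].
apply/eqP; rewrite addr_eq0 -sumrN; apply/eqP.
apply: eq_big => [[i j]|[i j] _] /=; last by rewrite lieC.
rewrite addnC; case: (_ == n) => //=; rewrite -leqNgt -val_eqE /=.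
by rewrite ltn_neqAle eq_sym andbC.
Qed.

Let sum_rot n (F : 'I_n -> 'I_n -> 'I_n -> FreeMetab) :
  \sum_i \sum_j \sum_k F i j k = \sum_k \sum_i \sum_j F i j k.
Proof.
by under eq_bigr => i _ do rewrite exchange_big /=; rewrite exchange_big.
Qed.

Let hbr3E' f g h n : hbr f (hbr g h) n = \sum_(i < n.+1) \sum_(j < n.+1) \sum_(k < n.+1)
  if (i + j + k == n)%N then [lie f i, [lie g j, h k]] else 0.
Proof.
by rewrite hbr3E; apply: eq_bigr => i _; apply: eq_bigr => j _; rewrite big_mkcond.
Qed.

Lemma hjacobi x y z : hbr x (hbr y z) + hbr y (hbr z x) + hbr z (hbr x y) = 0.
Proof.
apply: hatFP => n; rewrite !hcompD hcomp0 !hbr3E'.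
rewrite [X in _ + X + _]sum_rot [X in _ + X]sum_rot [X in _ + X]sum_rot.
rewrite -!big_split big1 // => i _; rewrite -!big_split big1 // => j _.
rewrite -!big_split big1 // => k _ /=.
have -> : (j + k + i = i + j + k)%N by rewrite addnC addnA.
have -> : (k + i + j = i + j + k)%N by rewrite -addnA addnC.
case: ifP => _; last by rewrite !addr0.
exact: lie_jacobi.
Qed.


HB.instance Definition _ := Lmodule_isLie.Build K hatF
  hbrDl hbrZl hbrDr hbrZr hbrxx hjacobi.
End FreeMetabelian.

Section PowerSeries.
Variables (K : fieldType) (m : nat).

(* K[[t_1, ..., t_m]]: a series is the family of its coefficients *)
Definition mseries := 'X_{1..m} -> K^o.
HB.instance Definition _ := GRing.Lmodule.on mseries.
Implicit Types p q r : mseries.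

Definition mseries_one : mseries := fun mu => (mu == 0%MM)%:R.
Definition mseries_mul p q : mseries := fun mu =>
  \sum_(k : 'X_{1..m < (mdeg mu).+1, (mdeg mu).+1} | mu == (k.1 + k.2)%MM)
    p k.1 * q k.2.

Let tr N p : {mpoly K[m]} := \sum_(k : 'X_{1..m < N}) p k *: 'X_[k].

Let trE N p mu : (mdeg mu < N)%N -> (tr N p)@_mu = p mu.
Proof. by move=> h; rewrite /tr mcoeff_mpoly. Qed.

Let mulE N p q mu : (mdeg mu < N)%N -> mseries_mul p q mu = (tr N p * tr N q)@_mu.
Proof.
move=> h; rewrite mcoeffM; apply: eq_bigr => -[k1 k2] _ /=.
by rewrite !trE // (leq_trans (bmdeg _)).
Qed.

Let mul_cong N (a a' b b' : {mpoly K[m]}) mu : (mdeg mu < N)%N ->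
  (forall nu, (mdeg nu < N)%N -> a@_nu = a'@_nu) ->
  (forall nu, (mdeg nu < N)%N -> b@_nu = b'@_nu) -> (a * b)@_mu = (a' * b')@_mu.
Proof.
move=> h ha hb; rewrite !mcoeffM; apply: eq_bigr => -[k1 k2] _ /=.
by rewrite ha ?hb // (leq_trans (bmdeg _)).
Qed.

Let tr_mul N p q mu : (mdeg mu < N)%N ->
  (tr N (mseries_mul p q))@_mu = (tr N p * tr N q)@_mu.
Proof. by move=> h; rewrite trE // (mulE _ _ h). Qed.

(* The ring structure is the convolution product, not the pointwise one that
   the function type carries. *)
Lemma mseries_mulA : associative mseries_mul.
Proof.
move=> p q r; apply/funext => mu; rewrite !(mulE _ _ (ltnSn (mdeg mu))).
rewrite (mul_cong (ltnSn _) (fun nu _ => erefl) (@tr_mul _ q r)) mulrA.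
by rewrite [RHS](mul_cong (ltnSn _) (@tr_mul _ p q) (fun nu _ => erefl)).
Qed.

Lemma mseries_mulC : commutative mseries_mul.
Proof.
by move=> p q; apply/funext => mu; rewrite !(mulE _ _ (ltnSn (mdeg mu))) mulrC.
Qed.

Lemma mseries_mul1 : left_id mseries_one mseries_mul.
Proof.
move=> p; apply/funext => mu; rewrite (mulE _ _ (ltnSn (mdeg mu))).
rewrite (@mul_cong (mdeg mu).+1 _ 1 _ (tr (mdeg mu).+1 p) _ (ltnSn _)) ?mul1r ?trE //.
by move=> nu h; rewrite trE // mcoeff1.
Qed.

Lemma mseries_mulDl : left_distributive mseries_mul +%R.
Proof.
move=> p q r; apply/funext => mu; rewrite /mseries_mul -[RHS]big_split /=.
by apply: eq_bigr => k _; rewrite -mulrDl.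
Qed.

Lemma mseries_one_neq0 : mseries_one != 0.
Proof.
apply/eqP => /(congr1 (fun p : mseries => p 0%MM)) /eqP.
by rewrite /mseries_one eqxx -[_ == _]/((1 : K) == 0) oner_eq0.
Qed.

HB.instance Definition _ := GRing.Zmodule_isComNzRing.Build mseries
  mseries_mulA mseries_mulC mseries_mul1 mseries_mulDl mseries_one_neq0.

Definition mseries_var (i : 'I_m) : mseries := fun mu => (mu == U_(i)%MM)%:R.

Definition indep_of (i : 'I_m) p := forall mu : 'X_{1..m}, mu i != 0%N -> p mu = 0.

End PowerSeries.

Section Wreath.
Variables (K : fieldType) (m : nat).

(* The abelian wreath product C_m + B_m: the pair (c, b) stands for
   \sum_i a_i c_i + \sum_j b_j beta_j, with beta_j the j-th value of b. *)
Definition wreath := ({ffun 'I_m -> {mpoly K[m]}} * {ffun 'I_m -> K^o})%type.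
HB.instance Definition _ := GRing.Lmodule.on wreath.
Implicit Types u v w : wreath.

Definition wact (b : {ffun 'I_m -> K^o}) : {mpoly K[m]} := \sum_j (b j : K) *: 'X_j.

(* [a_i f, b_j] = a_i f t_j, [C_m, C_m] = [B_m, B_m] = 0 *)
Definition wbr u v : wreath :=
  ([ffun i => u.1 i * wact v.2 - v.1 i * wact u.2], 0).

Lemma wactD b c : wact (b + c) = wact b + wact c.
Proof. by rewrite -big_split; apply: eq_bigr => j _; rewrite ffunE scalerDl. Qed.
Lemma wactZ (a : K) b : wact (a *: b) = a *: wact b.
Proof. by rewrite scaler_sumr; apply: eq_bigr => j _; rewrite ffunE -scalerA. Qed.
Lemma wact0 : wact 0 = 0.
Proof. by rewrite /wact big1 // => j _; rewrite ffunE scale0r. Qed.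

Lemma wreathP u v : u.1 = v.1 -> u.2 = v.2 -> u = v.
Proof. by case: u v => [? ?] [? ?] /= -> ->. Qed.

Lemma wbrDl u v w : wbr (u + v) w = wbr u w + wbr v w.
Proof.
apply: wreathP; last by rewrite /= addr0.
by apply/ffunP => i; rewrite !ffunE wactD; ring.
Qed.
Lemma wbrZl (a : K) u v : wbr (a *: u) v = a *: wbr u v.
Proof.
apply: wreathP; last by rewrite /= scaler0.
by apply/ffunP => i; rewrite !ffunE wactZ scalerBr -scalerAl -scalerAr.
Qed.
Lemma wbrxx u : wbr u u = 0.
Proof. by apply: wreathP => //; apply/ffunP => i; rewrite !ffunE subrr. Qed.
Lemma wbrC u v : wbr u v = - wbr v u.
Proof.
apply: wreathP; last by rewrite /= oppr0.
by apply/ffunP => i; rewrite !ffunE opprB.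
Qed.
Lemma wbrDr u v w : wbr u (v + w) = wbr u v + wbr u w.
Proof. by rewrite wbrC wbrDl opprD -!(wbrC u). Qed.
Lemma wbrZr (a : K) u v : wbr u (a *: v) = a *: wbr u v.
Proof. by rewrite wbrC wbrZl -scalerN -wbrC. Qed.
Lemma wbr_jacobi u v w : wbr u (wbr v w) + wbr v (wbr w u) + wbr w (wbr u v) = 0.
Proof.
apply: wreathP; last by rewrite /= !addr0.
by apply/ffunP => i; rewrite !ffunE /= !wact0; ring.
Qed.

HB.instance Definition _ := Lmodule_isLie.Build K wreath
  wbrDl wbrZl wbrDr wbrZr wbrxx wbr_jacobi.

Lemma wreath_metab (a b c d : wreath) : [lie [lie a, b], [lie c, d]] = 0.
Proof.
by apply: wreathP => //; apply/ffunP => i; rewrite !ffunE /= !wact0 !mulr0 subrr.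
Qed.

Definition wgen (i : 'I_m) : wreath :=
  ([ffun j => (j == i)%:R], [ffun j => (j == i)%:R]).

(* the homomorphism epsilon : y_i |-> a_i + b_i *)
Definition eps : FreeMetab K m -> wreath := fmet_lift wgen.

Lemma eps_gen i : eps (fmet_gen K i) = wgen i.
Proof. exact: (fmet_lift_gen _ wreath_metab). Qed.

Lemma eps_morphism : lie_morphism eps.
Proof. exact: (fmet_lift_morphism _ wreath_metab). Qed.

(* On a homogeneous element of degree k, the coordinates of epsilon in C_m
   are homogeneous of degree k - 1. *)
Lemma eps_homogF k x : homogF k x ->
  (k != 1%N -> (eps x).2 = 0) /\
  forall i (mu : 'X_{1..m}), (mdeg mu).+1 != k -> ((eps x).1 i)@_mu = 0.
Proof.
have wactE (b : {ffun 'I_m -> K^o}) (mu : 'X_{1..m}) : mdeg mu != 1%N -> (wact b)@_mu = 0.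
  move=> h; rewrite raddf_sum big1 //= => j _; rewrite mcoeffZ mcoeffX.
  by case: eqP => [e|_]; rewrite ?mulr0 //; rewrite -e mdeg1 in h.
have wmul j k' (p : {mpoly K[m]}) (b : {ffun 'I_m -> K^o}) (mu : 'X_{1..m}) :
    (k' != 1%N -> b = 0) -> (forall nu : 'X_{1..m}, (mdeg nu).+1 != j -> p@_nu = 0) ->
    (mdeg mu).+1 != (j + k')%N -> (p * wact b)@_mu = 0.
  move=> hb hp hmu; have [ek|/hb->] := eqVneq k' 1%N; last by rewrite wact0 mulr0 mcoeff0.
  rewrite mcoeffM big1 // => -[k1 k2] /= /eqP e.
  have [e2|ne] := eqVneq (mdeg k2) 1%N; last by rewrite (wactE _ _ ne) mulr0.
  rewrite hp ?mul0r //; apply: contra hmu => /eqP <-.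
  rewrite ek addn1 eqSS; apply/eqP; rewrite -addn1 -{1}e2 -mdegD.
  exact: congr1 e.
have e0 : eps 0 = 0.
  have := eps_morphism.1 (-1) 0 0; rewrite scaler0 addr0 scaleN1r.
  by rewrite addNr.
elim=> {k x} [i|j k x y _ [IHx2 IHx1] _ [IHy2 IHy1]|k|k a x y _ [IHx2 IHx1] _ [IHy2 IHy1]].
- split=> // l mu; rewrite eqSS mdeg_eq0 eps_gen ffunE => /negPf h.
  by case: (l == i); rewrite ?mcoeff0 // mcoeff1 h.
- rewrite eps_morphism.2; split=> // i mu h; rewrite ffunE mcoeffB.
  rewrite (wmul j k _ _ _ IHy2 (IHx1 i) h) sub0r.
  by rewrite (wmul k j _ _ _ IHx2 (IHy1 i)) ?oppr0 // addnC.
- by rewrite e0; split=> // i mu _; rewrite ffunE mcoeff0.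
- rewrite eps_morphism.1; split=> [h|i mu h].
    by rewrite /= IHx2 // IHy2 // scaler0 addr0.
  by rewrite !ffunE mcoeffD mcoeffZ IHx1 // IHy1 // mulr0 addr0.
Qed.

(* The partial derivative of f = f_1 + f_2 + ... with respect to y_i is
   \sum_k (df_k / dy_i); by eps_homogF only f_(|mu|+1) contributes to the
   coefficient of t^mu. *)
Definition hpartial (i : 'I_m) (f : hatF K m) : mseries K m :=
  fun mu => ((eps (f (mdeg mu).+1)).1 i)@_mu.

Lemma hgen_subproof (i : 'I_m) k : homogF k (if k == 1%N then fmet_gen K i else 0).
Proof. by case: eqP => [->|_]; [apply: homogF_gen|apply: homogF0]. Qed.

(* y_i as an element of the completion *)
Definition hgen (i : 'I_m) : hatF K m := mk_hatF (hgen_subproof i).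

Definition jacobian (phi : hatF K m -> hatF K m) : 'M[mseries K m]_m :=
  \matrix_(i, j) hpartial i (phi (hgen j)).

End Wreath.

Section Automorphisms.
Variables (K : fieldType) (m : nat).
Local Notation hF := (hatF K m).
Implicit Types (f g u v : hF) (phi : hF -> hF).

(* the k-th neighbourhood of 0 in the basis of the formal power series
   topology: the series starting in degree at least k *)
Definition hlower k : set hF := [set f | forall i, (i < k)%N -> f i = 0].

Definition hcontinuous phi := forall f k, exists l, forall g,
  hlower l (g - f) -> hlower k (phi g - phi f).

Definition hcvg (s : nat -> hF) f := forall k, exists N, forall n,
  (N <= n)%N -> hlower k (s n - f).

Definition continuous_aut : set (hF -> hF) :=
  [set phi | [/\ lie_morphism phi, bijective phi & hcontinuous phi]].

(* the commutator ideal: the series without linear part *)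
Definition hatF' : set hF := [set f | f 1%N = 0].

Definition IA : set (hF -> hF) :=
  [set phi | continuous_aut phi /\ forall f, hatF' (phi f - f)].

(* v (ad u) = [v, u] *)
Definition ad u v : hF := [lie v, u].

Lemma ad_lower u k j v : hlower k v -> hlower (k + j) (iter j (ad u) v).
Proof.
move=> hv; elim: j => [|j IH]; first by rewrite addn0.
move=> i hi /=; rewrite big1 // => l _.
have [h|h] := ltnP l (k + j)%N; first by rewrite IH // lie0x.
suff -> : (i - l = 0)%N by rewrite (homogF_deg0 (hatF_homog u 0)) liex0.
by apply/eqP; rewrite subn_eq0 (leq_trans _ h) // -ltnS -addnS.
Qed.

Lemma exp_ad_subproof u v n : homogF n
  (\sum_(k < n.+1) (k`!%:R : K)^-1 *: iter k (ad u) v n).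
Proof.
apply: homogF_sum => k _; rewrite -[_ *: _]addr0.
by apply: homogF_lin; [apply: hatF_homog|apply: homogF0].
Qed.

(* exp(ad u) = \sum_k (ad u)^k / k!; the terms with k > n vanish in degree n *)
Definition exp_ad u v : hF := mk_hatF (exp_ad_subproof u v).

Lemma exp_ad_cvg u v :
  hcvg (fun N => \sum_(k < N) (k`!%:R : K)^-1 *: iter k (ad u) v) (exp_ad u v).
Proof.
move=> d; exists d => N dN n nd; rewrite hcompD hcompN hcomp_sum /=.
rewrite (@big_ord_widen _ _ _ n.+1 N (fun k => (k`!%:R : K)^-1 *: iter k (ad u) v n)); last first.
  exact: leq_trans nd dN.
rewrite (bigID (fun k : 'I_N => (k < n.+1)%N)) /= addrAC subrr add0r big1 // => k.
have h0 : hlower 0 v by [].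
by rewrite -leqNgt => nk; apply: etrans (scaler0 _ _); congr (_ *: _); apply: (@ad_lower u 0 k v h0).
Qed.

Definition Inn : set (hF -> hF) := [set exp_ad u | u in setT].

Definition Inn_coset phi : set (hF -> hF) := [set psi \o phi | psi in Inn].

Definition IOut : set (set (hF -> hF)) := [set Inn_coset phi | phi in IA].

End Automorphisms.

(* Here m = n + 2 and indices are shifted by one: t_1 is the variable of index
   ord0, and i = 2, ..., m corresponds to i != ord0. *)
Section Theta.
Variables (K : fieldType) (n : nat).
Local Notation m := n.+2.
Local Notation S := (mseries K m).
Local Notation t := (@mseries_var K m).

Definition theta_matrix (s : S) (q r : 'I_m -> S) (f : 'I_m -> 'I_m -> S) : 'M[S]_m :=
  \matrix_(i, j)
    if j == ord0 then (if i == ord0 then s else t ord0 * q i + r i) else f i j.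

Definition theta_conditions (s : S) (q r : 'I_m -> S) (f : 'I_m -> 'I_m -> S) : Prop :=
  [/\ [/\ s 0%MM = 0,
          forall i, i != ord0 -> q i 0%MM = 0 /\ r i 0%MM = 0 &
          forall i j, j != ord0 -> f i j 0%MM = 0],
      [/\ s + \sum_(i | i != ord0) t i * q i = 0,
          \sum_(i | i != ord0) t i * r i = 0 &
          forall j, j != ord0 -> \sum_i t i * f i j = 0],
      [/\ indep_of ord0 s,
          forall i, i != ord0 -> indep_of ord0 (r i) &
          forall i, i != ord0 -> forall k : 'I_m, (k < i)%N -> indep_of k (q i)] &
      (* the coefficient of t_2 in f_12 *)
      f ord0 (lift ord0 ord0) U_(lift ord0 ord0)%MM = 0].

Definition Theta : set (hatF K m -> hatF K m) :=
  [set theta | continuous_aut theta /\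
    exists s q r f, theta_conditions s q r f /\
      jacobian theta = 1%:M + theta_matrix s q r f].

End Theta.

(* Main.v *)
(* By the partial derivatives D_i = d/dy_i, the completion is the space of
   vectors (f_1, ..., f_m) of power series for which t_1 f_1 + ... + t_m f_m is
   a linear form; injectivity and surjectivity both follow by expanding in the
   regular commutators [y_i, y_j1, ..., y_jk], i > j1 <= ... <= jk, whose
   coordinates are coefficients of the f_i.  With ubar = sum_i t_i D_i u and
   E(x) = (e^x - 1) / x one finds
     D_i (exp (ad u) v) = e^ubar D_i v - E(ubar) D_i u vbar,
   which reduces the group structure of Inn to identities between power series.

   On the first Jacobian column of phi in IA, exp (ad u) acts through ubar and
   through the subtraction of t_1 w, where w = E(ubar) (D_i u - beta_i)_i runs
   over all vectors with sum_i t_i w_i = 0.  The linear terms of the normal form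
   fix ubar: beta_2, ..., beta_m through the linear part of s, which must vanish,
   and beta_1 through the coefficient of t_2 in f_12.  Then w is determined by
   making s and the r_i free of t_1, and by splitting -s uniquely as
   sum_i t_i q_i according to the least variable of each monomial. *)
Require Import Defs.
From mathcomp Require Import all_boot all_order all_algebra.
From mathcomp Require Import boolp classical_sets functions.
From mathcomp Require Import mpoly.
From mathcomp Require Import ring.

Set Implicit Arguments.
Unset Strict Implicit.
Unset Printing Implicit Defensive.

Import GRing.Theory.
Local Open Scope ring_scope.
Local Open Scope quotient_scope.
Local Open Scope classical_set_scope.

(** * Formal power series *)

Section Series.
Variables (K : fieldType) (m : nat).
Local Notation S := (mseries K m).
Local Notation t := (@mseries_var K m).
Implicit Types (p q : S) (mu nu : 'X_{1..m}).

Lemma mserP p q : (forall mu, p mu = q mu) -> p = q.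
Proof. by move=> h; apply/funext. Qed.

Lemma mserD p q mu : (p + q) mu = p mu + q mu. Proof. by []. Qed.
Lemma mserN p mu : (- p) mu = - p mu. Proof. by []. Qed.
Lemma mserZ (a : K) p mu : (a *: p) mu = a * p mu. Proof. by []. Qed.
Lemma mserMn p k mu : (p *+ k) mu = p mu *+ k.
Proof. by elim: k => // k IH; rewrite !mulrS mserD IH. Qed.
Lemma mser1 mu : (1 : S) mu = (mu == 0%MM)%:R. Proof. by []. Qed.

Lemma mser_bool (b : bool) mu : (b%:R : S) mu = (b && (mu == 0%MM))%:R.
Proof. by case: b. Qed.

Lemma mser_sum I (r : seq I) (P : pred I) (F : I -> S) mu :
  (\sum_(i <- r | P i) F i) mu = \sum_(i <- r | P i) F i mu.
Proof. by apply: (big_morph (fun p : S => p mu)). Qed.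

Lemma mserM p q mu : (p * q) mu =
  \sum_(k : 'X_{1..m < (mdeg mu).+1, (mdeg mu).+1} | mu == (k.1 + k.2)%MM)
    p k.1 * q k.2.
Proof. by []. Qed.

Lemma mserZl (a : K) p q : (a *: p) * q = a *: (p * q).
Proof.
apply: mserP => mu; rewrite mserZ !mserM mulr_sumr.
by apply: eq_bigr => k _; rewrite mulrA.
Qed.

Lemma mserZr (a : K) p q : p * (a *: q) = a *: (p * q).
Proof. by rewrite mulrC mserZl mulrC. Qed.

(** Only coefficients of degree at most [mdeg mu] enter, so infinite sums may be truncated before
    multiplying. *)
Lemma mser_mul_cong p p' q q' mu :
  (forall nu, (mdeg nu <= mdeg mu)%N -> p nu = p' nu) ->
  (forall nu, (mdeg nu <= mdeg mu)%N -> q nu = q' nu) -> (p * q) mu = (p' * q') mu.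
Proof.
move=> hp hq; rewrite !mserM; apply: eq_bigr => -[k1 k2] _ /=.
by rewrite hp ?hq // -ltnS bmdeg.
Qed.

Definition of_poly (P : {mpoly K[m]}) : S := fun mu => P@_mu.

Lemma of_polyM P Q : of_poly (P * Q) = of_poly P * of_poly Q.
Proof. by apply: mserP => mu; rewrite /of_poly mcoeffM mserM. Qed.

Lemma mnm_subK mu i : mu i != 0%N -> (mu - U_(i) + U_(i))%MM = mu.
Proof. by move=> h; rewrite submK // lep1mP. Qed.

Lemma mdeg_subU mu i : mu i != 0%N -> (mdeg (mu - U_(i))%MM).+1 = mdeg mu.
Proof. by move=> h; rewrite -{2}(mnm_subK h) mdegD mdeg1 addn1. Qed.

Lemma mser_varM i p mu :
  (t i * p) mu = if mu i != 0%N then p (mu - U_(i))%MM else 0.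
Proof.
rewrite mserM; case: ifPn => h.
  pose N := (mdeg mu).+1.
  have h1 : (mdeg U_(i)%MM < N)%N by rewrite mdeg1 ltnS -(mdeg_subU h).
  have h2 : (mdeg (mu - U_(i))%MM < N)%N by rewrite /N -(mdeg_subU h) leqW.
  rewrite (bigD1 (BMultinom h1, BMultinom h2)) /=; last by rewrite addmC mnm_subK.
  rewrite /mseries_var eqxx mul1r big1 ?addr0 // => -[k1 k2] /= /andP[/eqP e ne].
  case: eqP => [e1|]; last by rewrite mul0r.
  case/eqP: ne; congr (_, _); apply: val_inj => //=.
  by rewrite e e1 addmC addmK.
rewrite big1 // => -[k1 k2] /= /eqP e; rewrite /mseries_var.
case: eqP => [e1|]; last by rewrite mul0r.
by case/negP: h; move/mnmP/(_ i): e; rewrite e1 mnmDE mnm1E eqxx => ->.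
Qed.

Lemma mser_varMU i p mu : (t i * p) (mu + U_(i))%MM = p mu.
Proof. by rewrite mser_varM mnmDE mnm1E eqxx addn1 /= addmK. Qed.

Lemma mser_var_inj i p : t i * p = 0 -> p = 0.
Proof. by move=> h; apply: mserP => mu; rewrite -(mser_varMU i) h. Qed.

Lemma mser_var0 i p : (t i * p) 0%MM = 0.
Proof. by rewrite mser_varM mnm0E. Qed.

Lemma mser_varU i j p : (t i * p) U_(j)%MM = if i == j then p 0%MM else 0.
Proof.
by rewrite mser_varM mnm1E; have [->|] := eqVneq j i; rewrite //= -[X in (X - _)%MM]add0m addmK.
Qed.

Lemma mser_sum_varU j (f : 'I_m -> S) : (\sum_i t i * f i) U_(j)%MM = f j 0%MM.
Proof.
rewrite mser_sum (bigD1 j) //= mser_varU eqxx big1 ?addr0 // => i /negPf h.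
by rewrite mser_varU h.
Qed.

Lemma mserM0 p q : (p * q) 0%MM = p 0%MM * q 0%MM.
Proof.
have h : (mdeg (0%MM : 'X_{1..m}) < (mdeg (0%MM : 'X_{1..m})).+1)%N by [].
rewrite mserM (big_pred1 (BMultinom h, BMultinom h)) //= => -[k1 k2] /=.
rewrite eq_sym mnmD_eq0 xpair_eqE -!val_eqE /=.
by [].
Qed.

(** * Order of vanishing, homogeneous series and infinite sums *)

Definition vanish_below k p := forall mu, (mdeg mu < k)%N -> p mu = 0.
Definition homog_ser k p := forall mu, mdeg mu != k -> p mu = 0.

Lemma vanish_belowM a b p q :
  vanish_below a p -> vanish_below b q -> vanish_below (a + b)%N (p * q).
Proof.
move=> hp hq mu h; rewrite mserM big1 // => -[k1 k2] /= /eqP.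
move: (k1 : 'X_{1..m}) (k2 : 'X_{1..m}) => {}k1 {}k2 /(congr1 mdeg); rewrite mdegD => e.
have [l|l] := ltnP (mdeg k1) a; first by rewrite hp ?mul0r.
rewrite hq ?mulr0 // -(ltn_add2l a); apply: leq_ltn_trans h.
by rewrite e leq_add2r.
Qed.

Lemma homog_serM a b p q :
  homog_ser a p -> homog_ser b q -> homog_ser (a + b)%N (p * q).
Proof.
move=> hp hq mu h; rewrite mserM big1 // => -[k1 k2] /= /eqP.
move: (k1 : 'X_{1..m}) (k2 : 'X_{1..m}) => {}k1 {}k2 /(congr1 mdeg); rewrite mdegD => e.
have [l|l] := eqVneq (mdeg k1) a; last by rewrite hp ?mul0r.
rewrite hq ?mulr0 //; apply: contraNneq h => <-.
by rewrite e l.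
Qed.

Lemma homog_ser1 : homog_ser 0 1.
Proof. by move=> mu; rewrite mdeg_eq0 mser1 => /negPf->. Qed.

Lemma homog_serX k p n : homog_ser k p -> homog_ser (k * n)%N (p ^+ n).
Proof.
move=> hp; elim: n => [|n IH]; first by rewrite muln0 expr0; apply: homog_ser1.
by rewrite exprS mulnS; apply: homog_serM.
Qed.

Lemma homog_serX1 p n : homog_ser 1 p -> homog_ser n (p ^+ n).
Proof. by move=> hp; rewrite -[n in homog_ser n]mul1n; apply: homog_serX. Qed.

Lemma homog_serD k p q : homog_ser k p -> homog_ser k q -> homog_ser k (p + q).
Proof. by move=> hp hq mu h; rewrite mserD hp ?hq ?addr0. Qed.

Lemma homog_serN k p : homog_ser k p -> homog_ser k (- p).
Proof. by move=> hp mu h; rewrite mserN hp ?oppr0. Qed.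

Lemma homog_serZ k a p : homog_ser k p -> homog_ser k (a *: p).
Proof. by move=> hp mu h; rewrite mserZ hp ?mulr0. Qed.

(** The infinite sum of the [h k], meant for [h k] homogeneous of degree [k]: a single term then
    contributes to each coefficient. *)
Definition sum_homog (h : nat -> S) : S := fun mu => h (mdeg mu) mu.

Lemma sum_homogE h N mu : (forall k, homog_ser k (h k)) -> (mdeg mu < N)%N ->
  sum_homog h mu = (\sum_(k < N) h k) mu.
Proof.
move=> hh lt; rewrite mser_sum (bigD1 (Ordinal lt)) //= big1 ?addr0 // => k ne.
by rewrite hh //; apply: contraNneq ne => e; apply/eqP/val_inj.
Qed.

Lemma sum_homogM h p mu : (forall k, homog_ser k (h k)) ->
  (sum_homog h * p) mu = \sum_(k < (mdeg mu).+1) (h k * p) mu.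
Proof.
move=> hh; rewrite (@mser_mul_cong _ (\sum_(k < (mdeg mu).+1) h k) _ p) //.
  by rewrite mulr_suml mser_sum.
by move=> nu le; apply: sum_homogE.
Qed.

Lemma vanish_belowX p n : p 0%MM = 0 -> vanish_below n (p ^+ n).
Proof.
move=> p0; elim: n => [|n IH]; first by [].
rewrite exprS -add1n; apply: vanish_belowM IH => mu.
by rewrite ltnS leqn0 mdeg_eq0 => /eqP->.
Qed.

(* q is the geometric series in 1 - p. *)
Lemma mser_inv p : p 0%MM = 1 -> {q : S | p * q = 1 & q 0%MM = 1}.
Proof.
move=> p1; pose r : S := 1 - p.
have r0 : r 0%MM = 0 by rewrite /r mserD mserN mser1 eqxx p1 subrr.
(* The powers [r ^+ k] with [k > mdeg mu] do not reach [mu], because [r] has no constant term. *)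
pose q : S := fun mu => (\sum_(k < (mdeg mu).+1) r ^+ k) mu.
have qE N mu : (mdeg mu < N)%N -> q mu = (\sum_(k < N) r ^+ k) mu.
  move=> lt; rewrite /q !mser_sum (big_ord_widen N (fun k => (r ^+ k) mu)) //.
  rewrite [RHS](bigID (fun k : 'I_N => (k < (mdeg mu).+1)%N)) /= [X in _ + X]big1 ?addr0 // => k.
  by rewrite -leqNgt; apply: vanish_belowX.
have h : p * q = 1.
  apply: mserP => mu.
  rewrite (@mser_mul_cong _ p _ (\sum_(k < (mdeg mu).+1) r ^+ k)) //; last first.
    by move=> nu le; apply: qE.
  have -> : p = 1 - r by rewrite /r opprB addrC subrK.
  (* Telescoping gives [1 - r ^+ (mdeg mu).+1], whose last term vanishes at [mu]. *)
  rewrite -opprB mulNr -subrX1 opprB mserD mserN vanish_belowX ?subr0 //.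
exists q => //.
by move/(congr1 (fun f : S => f 0%MM)): h; rewrite mserM0 p1 mul1r mser1 eqxx.
Qed.

Definition lin_form (b : 'I_m -> K) : S := \sum_i b i *: t i.

Lemma homog_var i : homog_ser 1 (t i).
Proof. by move=> mu; rewrite /mseries_var; by case: (mu =P _) => // ->; rewrite mdeg1. Qed.

Lemma lin_form_homog b : homog_ser 1 (lin_form b).
Proof.
move=> mu h; rewrite /lin_form mser_sum big1 // => i _.
by rewrite mserZ homog_var ?mulr0.
Qed.

Lemma lin_form_U b j : lin_form b U_(j)%MM = b j.
Proof.
rewrite /lin_form mser_sum (bigD1 j) //= mserZ /mseries_var eqxx mulr1 big1 ?addr0 // => i /negPf ne.
by rewrite mserZ eq_mnm1 eq_sym ne mulr0.
Qed.

Lemma lin_formM b p mu : (lin_form b * p) mu = \sum_i b i * (t i * p) mu.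
Proof.
rewrite /lin_form; elim/big_rec2: _ => [|i u v _ <-]; first by rewrite mul0r.
by rewrite mulrDl mserD mserZl mserZ.
Qed.

Lemma mdeg1E mu : mdeg mu = 1%N -> exists i, mu = U_(i)%MM.
Proof. by move/eqP/mdeg1P => -[i /eqP->]; exists i. Qed.

Lemma homog1_lin_form p : homog_ser 1 p -> p = lin_form (fun j => p U_(j)%MM).
Proof.
move=> hp; apply: mserP => mu; have [e|ne] := eqVneq (mdeg mu) 1%N; last first.
  by rewrite hp // lin_form_homog.
by have [i ->] := mdeg1E e; rewrite lin_form_U.
Qed.

(** Only the constant and linear parts of [p] matter, so [p] is replaced by their sum. *)
Lemma mserMU p q k : (p * q) U_(k)%MM = p 0%MM * q U_(k)%MM + p U_(k)%MM * q 0%MM.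
Proof.
pose l := lin_form (fun j => p U_(j)%MM).
rewrite (@mser_mul_cong _ ((p 0%MM : K) *: (1 : S) + l) _ q) // => [|nu].
  rewrite mulrDl mserZl mul1r mserD mserZ lin_formM (bigD1 k) //= mser_varU eqxx.
  by rewrite big1 ?addr0 // => i ne; rewrite mser_varU (negPf ne) mulr0.
rewrite mdeg1 mserD mserZ mser1; case E: (mdeg nu) => [|[|//]] _.
  by move/eqP: E; rewrite mdeg_eq0 => /eqP ->; rewrite eqxx mulr1 /l lin_form_homog ?addr0 ?mdeg0.
have [i ->] := mdeg1E E.
by rewrite /l lin_form_U -mdeg_eq0 mdeg1 mulr0 add0r.
Qed.

Lemma mser_sum_cond_varU (P : pred 'I_m) j (f : 'I_m -> S) :
  (\sum_(i | P i) t i * f i) U_(j)%MM = if P j then f j 0%MM else 0.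
Proof.
rewrite big_mkcond mser_sum (bigD1 j) //= big1 ?addr0 => [|i ne].
  by case: ifP => // _; rewrite mser_varU eqxx.
by case: ifP => // _; rewrite mser_varU (negPf ne).
Qed.

(** * The exponential of a linear form *)

Definition exp_quot (x : S) : S :=
  sum_homog (fun k => (k.+1`!%:R : K)^-1 *: x ^+ k).
(** e^x is built from E(x) so that e^x - 1 = x E(x) holds by unfolding and identities between the
    two are left to [ring]; [exp_serE] recovers the usual expansion. *)
Definition exp_ser (x : S) : S := 1 + x * exp_quot x.

Section Exp.
Variable x : S.
Hypothesis hx : homog_ser 1 x.

Lemma homog1_0 : x 0%MM = 0. Proof. by apply: hx; rewrite mdeg0. Qed.

Lemma exp_quot0 : exp_quot x 0%MM = 1.
Proof. by rewrite /exp_quot /sum_homog mdeg0 mserZ expr0 mser1 eqxx invr1 mulr1. Qed.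

Lemma exp_ser0 : exp_ser x 0%MM = 1.
Proof. by rewrite /exp_ser mserD mserM0 homog1_0 mul0r addr0 mser1 eqxx. Qed.

Lemma exp_quotM p mu : (exp_quot x * p) mu =
  \sum_(k < (mdeg mu).+1) (k.+1`!%:R : K)^-1 * (x ^+ k * p) mu.
Proof.
rewrite sum_homogM => [|k]; last by apply/homog_serZ/homog_serX1.
by apply: eq_bigr => k _; rewrite mserZl mserZ.
Qed.

Lemma exp_serE : exp_ser x = sum_homog (fun k => (k`!%:R : K)^-1 *: x ^+ k).
Proof.
apply: mserP => mu; rewrite /exp_ser mserD mulrC exp_quotM /sum_homog.
case E: (mdeg mu) => [|d].
  have -> : mu = 0%MM by apply/eqP; rewrite -mdeg_eq0 E.
  by rewrite big_ord1 expr0 mul1r homog1_0 mulr0 addr0 mserZ invr1 mul1r.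
rewrite mser1 -mdeg_eq0 E add0r.
have hd : (d < d.+2)%N by rewrite ltnW.
rewrite (bigD1 (Ordinal hd)) //= big1 ?addr0 => [|k ne]; last first.
  rewrite -exprSr homog_serX1 ?mulr0 // E; apply: contraNneq ne => -[e].
  by apply/eqP/val_inj.
by rewrite -exprSr mserZ.
Qed.

Lemma exp_ser_U j : exp_ser x U_(j)%MM = x U_(j)%MM.
Proof. by rewrite exp_serE /sum_homog mserZ mdeg1 expr1 invr1 mul1r. Qed.

End Exp.

Hypothesis char0 : [pchar K] =i pred0.

Lemma fact_neq0 n : n`!%:R != 0 :> K.
Proof. by rewrite ((pcharf0P K).1 char0) // -lt0n fact_gt0. Qed.

(** The binomial theorem, degree by degree; characteristic 0 makes the factorials and binomial
    coefficients invertible. *)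
Lemma exp_serD x y : homog_ser 1 x -> homog_ser 1 y ->
  exp_ser (x + y) = exp_ser x * exp_ser y.
Proof.
move=> hx hy; rewrite (exp_serE (homog_serD hx hy)) (exp_serE hx) (exp_serE hy).
have hX z k : homog_ser 1 z -> homog_ser k ((k`!%:R : K)^-1 *: z ^+ k).
  by move=> hz; apply/homog_serZ/homog_serX1.
apply: mserP => mu; rewrite sum_homogM => [|k]; last exact: hX.
set d := mdeg mu.
(* [addrC] makes [i] the exponent of [x] in [exprDn], as in the sum on the right. *)
rewrite {1}/sum_homog -/d mserZ addrC exprDn mser_sum mulr_sumr.
apply: eq_bigr => i _; have le : (i <= d)%N by rewrite -ltnS.
rewrite [in RHS]mulrC sum_homogM => [|k]; last exact: hX.
have hd : (d - i < d.+1)%N by rewrite ltnS leq_subr.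
rewrite (bigD1 (Ordinal hd)) //= big1 ?addr0 => [|k ne]; last first.
  rewrite (homog_serM (hX _ _ hy) (hX _ _ hx)) // -/d.
  apply: contraNneq ne => e; apply/eqP/val_inj => /=.
  by apply: (can_inj (addnK i)); rewrite (subnK le); apply: esym e.
rewrite mserZl mserZr !mserZ mserMn -[_ *+ 'C(d, i)]mulr_natl !mulrA.
rewrite -(bin_fact le) !natrM; congr (_ * _).
have hb : 'C(d, i)%:R != 0 :> K by rewrite ((pcharf0P K).1 char0) // -lt0n bin_gt0.
have hi := fact_neq0 i; have hdi := fact_neq0 (d - i).
by field; apply/and3P.
Qed.

End Series.

(** * The free metabelian Lie algebra in its wreath product *)

Section LeastIndex.
Variable m : nat.
Implicit Types nu : 'X_{1..m.+1}.

(** At the monomial 1, where no variable occurs, the value is the default [ord0]. *)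
Definition least_index nu : 'I_m.+1 :=
  odflt ord0 [pick i | (nu i != 0%N) && [forall k : 'I_m.+1, (k < i)%N ==> (nu k == 0%N)]].

Lemma least_indexP nu : nu != 0%MM ->
  nu (least_index nu) != 0%N /\ forall k : 'I_m.+1, (k < least_index nu)%N -> nu k = 0%N.
Proof.
move=> nz; rewrite /least_index; case: pickP => [i /andP[h /forallP hk]|h] /=.
  by split=> // k /(implyP (hk k))/eqP.
have [i0 hi0] : exists i, nu i != 0%N.
  apply: contrapT => hn; case/eqP: nz; apply/mnmP => i; rewrite mnm0E.
  by apply/eqP/negbNE/negP => hi; apply: hn; exists i.
have [i hi min] := arg_minnP (P := fun i => nu i != 0%N) (fun i : 'I_m.+1 => i : nat) hi0.
have := h i; rewrite hi /= => /negbT/forallPn[k]; rewrite negb_imply => /andP[lt].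
by move=> /min; rewrite leqNgt lt.
Qed.

Lemma least_index_eq nu i : nu i != 0%N ->
  (forall k : 'I_m.+1, (k < i)%N -> nu k = 0%N) -> least_index nu = i.
Proof.
move=> hi hk; have [|h1 h2] := @least_indexP nu.
  by apply: contraNneq hi => ->; rewrite mnm0E.
apply/val_inj/eqP; rewrite /= eqn_leq leqNgt; apply/andP; split.
  by apply: contraNN hi => /h2 ->.
by rewrite leqNgt; apply: contraNN h1 => /hk ->.
Qed.

End LeastIndex.

Section Metabelian.
Variables (K : fieldType) (n : nat).
Local Notation m := n.+1.
Local Notation F := (FreeMetab K m).
Local Notation y := (@fmet_gen K m).
Implicit Types (x z : F) (mu nu : 'X_{1..m}).

Lemma fmet_metab (a b c d : F) : [lie [lie a, b], [lie c, d]] = 0.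
Proof.
elim/quotW: a => a; elim/quotW: b => b; elim/quotW: c => c; elim/quotW: d => d.
rewrite -!piFB -piF0; apply/piFP; rewrite subr0.
by apply: lie_span_br; apply: lie_span_br.
Qed.

(** * The action of monomials on commutators *)

Definition ady i x : F := [lie x, y i].

(** Every commutator has this property, F_m being metabelian; it makes the operators [ady i] commute
    on [x]. *)
Definition centralises_derived x := forall c d : F, [lie x, [lie c, d]] = 0.

Lemma centralises_br x z : centralises_derived [lie x, z].
Proof. by move=> c d; apply: fmet_metab. Qed.

(** In the Jacobi identity for x, y_i, y_j the term [x, [y_i, y_j]] vanishes. *)
Lemma adyC i j x : centralises_derived x -> ady i (ady j x) = ady j (ady i x).
Proof.
move=> hx; have := lie_jacobi x (y i) (y j); rewrite hx add0r.
rewrite (lieC (y i) [lie y j, x]) (lieC (y j) x) lieNx opprK.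
by rewrite (lieC (y j) [lie x, y i]) => /eqP; rewrite subr_eq0 => /eqP.
Qed.

(** The action of t^nu by iterated brackets, which makes F_m' a K[t_1, ..., t_m]-module. The
    brackets are taken in a fixed order of the variables; the list [s] is a parameter for
    induction. *)
Definition acts s nu x : F := foldr (fun i z => iter (nu i) (ady i) z) x s.
Definition act nu x : F := acts (enum 'I_m) nu x.

Lemma iter_ady_centr i k x : centralises_derived x -> centralises_derived (iter k (ady i) x).
Proof. by case: k => [//|k] _; apply: centralises_br. Qed.

Lemma acts_centr s nu x : centralises_derived x -> centralises_derived (acts s nu x).
Proof. by move=> hx; elim: s => //= i s IH; apply: iter_ady_centr. Qed.

Lemma iter_adyC i j k x : centralises_derived x ->
  ady j (iter k (ady i) x) = iter k (ady i) (ady j x).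
Proof.
move=> hx; elim: k => //= k IH; rewrite adyC ?IH //.
exact: iter_ady_centr.
Qed.

Lemma acts_ady s nu i x : centralises_derived x ->
  acts s nu (ady i x) = ady i (acts s nu x).
Proof.
move=> hx; elim: s => //= j s ->; rewrite iter_adyC //.
exact: acts_centr.
Qed.

Lemma actsU s nu i x : centralises_derived x -> uniq s ->
  acts s (nu + U_(i)) x = if i \in s then ady i (acts s nu x) else acts s nu x.
Proof.
move=> hx; elim: s => //= j s IH /andP[js us]; rewrite IH // inE mnmDE mnm1E.
have [->|ne] := eqVneq i j; first by rewrite (negPf js) addn1 /=.
rewrite addn0 /=; case: ifP => // _; rewrite iter_adyC //.
exact: acts_centr.
Qed.

Lemma actU nu i x : centralises_derived x -> act (nu + U_(i)) x = ady i (act nu x).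
Proof. by move=> hx; rewrite /act actsU ?enum_uniq // mem_enum. Qed.

Lemma actU' nu i x : centralises_derived x -> act (nu + U_(i)) x = act nu (ady i x).
Proof. by move=> hx; rewrite actU // /act acts_ady. Qed.

Lemma act0 x : act 0%MM x = x.
Proof. by rewrite /act; elim: (enum 'I_m) => //= i s ->; rewrite mnm0E. Qed.

Lemma iter_adyB i k x z : iter k (ady i) (x - z) = iter k (ady i) x - iter k (ady i) z.
Proof. by elim: k => //= k ->; rewrite /ady lieDl lieNx. Qed.

Lemma actB nu x z : act nu (x - z) = act nu x - act nu z.
Proof. by rewrite /act; elim: (enum 'I_m) => //= i s ->; rewrite iter_adyB. Qed.

Lemma act_zero nu : act nu 0 = 0.
Proof. by have := actB nu 0 0; rewrite !subrr. Qed.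

Lemma actN nu x : act nu (- x) = - act nu x.
Proof. by rewrite -sub0r actB act_zero sub0r. Qed.

Lemma addmAC mu nu rho : (mu + nu + rho = mu + rho + nu)%MM.
Proof. by rewrite -!addmA (addmC nu). Qed.

Lemma mnm_ind (P : 'X_{1..m} -> Prop) :
  P 0%MM -> (forall nu i, P nu -> P (nu + U_(i))%MM) -> forall nu, P nu.
Proof.
move=> P0 PU nu; move Ed: (mdeg nu) => d; elim: d nu Ed => [|d IH] nu e.
  by move/eqP: e; rewrite mdeg_eq0 => /eqP->.
have nz : nu != 0%MM by rewrite -mdeg_eq0 e.
have [h _] := least_indexP nz.
rewrite -(mnm_subK h); apply: PU; apply: IH.
by apply: succn_inj; rewrite mdeg_subU.
Qed.

Lemma homogF_act nu x k : centralises_derived x -> homogF k x ->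
  homogF (k + mdeg nu) (act nu x).
Proof.
move=> hx hk; elim/mnm_ind: nu => [|nu i IH]; first by rewrite act0 mdeg0 addn0.
by rewrite actU // mdegD mdeg1 addnA; apply: homogF_br IH (homogF_gen _ _).
Qed.

(* The regular commutators: for mu <> 0 and i > p, where p is the least index
   occurring in mu, this is [y_i, y_p, y_j2, ..., y_jk] with
   t^mu = t_p t_j2 ... t_jk; it is 0 when i <= p. *)
Definition regular_comm i mu : F :=
  if mu == 0%MM then y i else
  let p := least_index (mu + U_(i))%MM in act (mu - U_(p))%MM [lie y i, y p].

Lemma homogF_regular_comm i mu : homogF (mdeg mu).+1 (regular_comm i mu).
Proof.
rewrite /regular_comm; case: eqP => [->|/eqP nz]; first by rewrite mdeg0; apply: homogF_gen.
set p := least_index _.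
have /least_indexP[hp _] : (mu + U_(i))%MM != 0%MM by rewrite mnmD_eq0 (negPf nz).
have [e|ne] := eqVneq i p; first by rewrite -e liexx act_zero; apply: homogF0.
have hmu : mu p != 0%N by move: hp; rewrite -/p mnmDE mnm1E (negPf ne) addn0.
rewrite -(mdeg_subU hmu) -add2n; apply: homogF_act; first exact: centralises_br.
by apply: (homogF_br (homogF_gen _ _) (homogF_gen _ _)).
Qed.

(** Straightening of a commutator into regular ones. If the least index p of t^nu t_i t_j is i or j,
    one term on the right is zero. Otherwise t_p divides t^nu, and the Jacobi identity replaces
    [y_i, y_j, y_p] by [y_i, y_p, y_j] - [y_j, y_p, y_i]. *)
Lemma act_regular nu i j :
  act nu [lie y i, y j] = regular_comm i (nu + U_(j))%MM - regular_comm j (nu + U_(i))%MM.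
Proof.
have nz k : (nu + U_(k))%MM == 0%MM = false.
  by rewrite mnmD_eq0 -(mdeg_eq0 U_(k)%MM) mdeg1 andbF.
rewrite /regular_comm !nz (addmAC nu U_(i)%MM) /=.
set p := least_index _.
have /least_indexP[hp _] : (nu + U_(j) + U_(i))%MM != 0%MM by rewrite mnmD_eq0 nz.
rewrite -/p in hp.
have [ei|nei] := eqVneq i p.
  by rewrite -ei liexx act_zero sub0r addmK (lieC (y j)) actN opprK.
have [ej|nej] := eqVneq j p; first by rewrite -ej liexx act_zero subr0 addmK.
have hnu : nu p != 0%N by move: hp; rewrite !mnmDE !mnm1E (negPf nei) (negPf nej) !addn0.
rewrite -(mnm_subK hnu); set nu' := (nu - U_(p))%MM.
rewrite !(addmAC nu' U_(p)%MM) !addmK !actU'; try exact: centralises_br.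
rewrite -actB; congr act; rewrite /ady.
have := lie_jacobi (y p) (y i) (y j).
rewrite (lieC (y p) [lie _, _]) (lieC (y i) [lie _, _]) (lieC (y j) [lie _, _]).
rewrite (lieC (y p) (y i)) lieNx opprK -addrA => /eqP.
by rewrite addrC addr_eq0 opprK addrC => /eqP ->.
Qed.

(** An induction principle for the graded components with generators and the [y_i, y_j] t^nu in
    place of all brackets. Here i, j and nu are unrestricted; [act_regular] does the reduction to
    regular commutators. *)
Inductive regular_span : nat -> F -> Prop :=
  | regular_span_gen i : regular_span 1 (y i)
  | regular_span_br nu i j : regular_span (mdeg nu).+2 (act nu [lie y i, y j])
  | regular_span0 k : regular_span k 0
  | regular_span_lin k (a : K) x z :
      regular_span k x -> regular_span k z -> regular_span k (a *: x + z).

Lemma regular_spanN k x : regular_span k x -> regular_span k (- x).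
Proof.
by move=> h; rewrite -scaleN1r -[_ *: _]addr0; apply: regular_span_lin => //; apply: regular_span0.
Qed.

(** Bracketing a commutator with a generator multiplies it by a variable, and two commutators have
    bracket zero. *)
Lemma regular_span_lie k l x z :
  regular_span k x -> regular_span l z -> regular_span (k + l) [lie x, z].
Proof.
elim=> {k x} [i|nu i j|k|k a x1 x2 _ IH1 _ IH2] hz; last 2 first.
- by rewrite lie0x; apply: regular_span0.
- by rewrite lieDl lieZl; apply: regular_span_lin; [apply: IH1|apply: IH2].
- elim: hz => {l z} [j|nu' j j'|k|k a x1 x2 _ IH1 _ IH2].
  + by have := regular_span_br 0%MM i j; rewrite act0 mdeg0.
  + rewrite lieC -[[lie _, y i]]/(ady i _) -actU; last exact: centralises_br.
    by apply: regular_spanN; have := regular_span_br (nu' + U_(i)) j j'; rewrite mdegD mdeg1 addn1.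
  + by rewrite liex0; apply: regular_span0.
  + by rewrite lieDr lieZr; apply: regular_span_lin.
- elim: hz => {l z} [j'|nu' j' j''|k|k a x1 x2 _ IH1 _ IH2].
  + rewrite -[[lie _, y j']]/(ady j' _) -actU; last exact: centralises_br.
    by have := regular_span_br (nu + U_(j')) i j; rewrite mdegD mdeg1 !addn1.
  + have hc := @acts_centr (enum 'I_m) nu _ (@centralises_br (y i) (y j)).
    suff -> : [lie act nu [lie y i, y j], act nu' [lie y j', y j'']] = 0 by apply: regular_span0.
    elim/mnm_ind: nu' => [|nu' k IH]; first by rewrite act0; apply: hc.
    by rewrite actU; [apply: hc|apply: centralises_br].
  + by rewrite liex0; apply: regular_span0.
  + by rewrite lieDr lieZr; apply: regular_span_lin.
Qed.

Lemma homogF_regular k x : homogF k x -> regular_span k x.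
Proof.
elim=> {k x} *; [exact: regular_span_gen|exact: regular_span_lie|
  exact: regular_span0|exact: regular_span_lin].
Qed.

(** * The image of the embedding into the wreath product *)

Local Notation eps := (@eps K m).

Lemma epsP (a : K) x z : eps (a *: x + z) = a *: eps x + eps z.
Proof. exact: (eps_morphism K m).1. Qed.
Lemma eps0 : eps 0 = 0.
Proof. by have := epsP (-1) 0 0; rewrite scaler0 addr0 scaleN1r addNr. Qed.
Lemma epsZ (a : K) x : eps (a *: x) = a *: eps x.
Proof. by rewrite -[a *: x]addr0 epsP eps0 addr0. Qed.
Lemma epsD x z : eps (x + z) = eps x + eps z.
Proof. by rewrite -[x]scale1r epsP !scale1r. Qed.
Lemma mcoeff_eps_sum I (r : seq I) (P : pred I) (G : I -> F) l mu :
  ((eps (\sum_(i <- r | P i) G i)).1 l)@_mu = \sum_(i <- r | P i) ((eps (G i)).1 l)@_mu.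
Proof.
apply: (big_morph (fun x => ((eps x).1 l)@_mu)) => [x z|].
  by rewrite epsD ffunE mcoeffD.
by rewrite eps0 ffunE mcoeff0.
Qed.
Lemma epsB x z : eps [lie x, z] = [lie eps x, eps z].
Proof. exact: (eps_morphism K m).2. Qed.

Lemma wact_gen i : wact (wgen K i).2 = 'X_i :> {mpoly K[m]}.
Proof.
rewrite /wact (bigD1 i) //= ffunE eqxx scale1r big1 ?addr0 // => j /negPf ne.
by rewrite ffunE ne scale0r.
Qed.

(** The rule [a_i f, b_j] = a_i f t_j turns the action of t^nu into multiplication. *)
Lemma eps_act nu x : centralises_derived x -> (eps x).2 = 0 ->
  (eps (act nu x)).2 = 0 /\ forall l, (eps (act nu x)).1 l = (eps x).1 l * 'X_[nu].
Proof.
move=> hx h0; elim/mnm_ind: nu => [|nu i [IH2 IH1]].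
  by rewrite act0; split=> // l; rewrite mpolyX0 mulr1.
rewrite actU // /ady epsB eps_gen; split=> // l.
by rewrite ffunE /= IH2 wact0 mulr0 subr0 wact_gen IH1 mpolyXD mulrA.
Qed.

Lemma eps_act_br nu i j l : (eps (act nu [lie y i, y j])).1 l =
  (l == i)%:R * 'X_[nu + U_(j)] - (l == j)%:R * 'X_[nu + U_(i)].
Proof.
have h2 : (eps [lie y i, y j]).2 = 0 by rewrite epsB.
have [_ ->] := eps_act nu (@centralises_br (y i) (y j)) h2.
rewrite epsB !eps_gen !ffunE !wact_gen mulrBl -!mulrA -!mpolyXD.
by rewrite ![(U_(_) + nu)%MM]addmC.
Qed.

Lemma regular_comm_expansion k N x : (k <= N)%N -> homogF k x ->
  x = \sum_i \sum_(mu : 'X_{1..m < N}) ((eps x).1 i)@_mu *: regular_comm i mu.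
Proof.
move=> kN /homogF_regular; move: kN => /[swap].
elim=> {k x} [i|nu i j|k|k a x z _ IH1 _ IH2] kN; last 2 first.
- rewrite eps0 big1 // => i _; rewrite big1 // => mu _.
  by rewrite ffunE mcoeff0 scale0r.
- rewrite {1}(IH1 kN) {1}(IH2 kN) epsP scaler_sumr -big_split; apply: eq_bigr => i _ /=.
  rewrite scaler_sumr -big_split; apply: eq_bigr => mu _ /=.
  by rewrite !ffunE mcoeffD mcoeffZ scalerDl scalerA.
- rewrite eps_gen (bigD1 i) //= [X in _ + X]big1 ?addr0 => [|l ne]; last first.
    by rewrite big1 // => mu _; rewrite ffunE (negPf ne) mcoeff0 scale0r.
  have h0 : (mdeg (0%MM : 'X_{1..m}) < N)%N by rewrite mdeg0.
  rewrite (bigD1 (BMultinom h0)) //= big1 ?addr0 => [|mu ne]; last first.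
    rewrite ffunE eqxx mcoeff1; case: eqP => [e|]; last by rewrite scale0r.
    by case/eqP: ne; apply: val_inj.
  by rewrite ffunE eqxx mcoeff1 eqxx scale1r /regular_comm eqxx.
- have hsum l c nu' : (mdeg nu' < N)%N ->
     \sum_(mu : 'X_{1..m < N}) ((l == c)%:R * 'X_[K, nu'])@_mu *: regular_comm l mu =
     if l == c then regular_comm l nu' else 0.
    move=> hN; case: eqP => [_|_]; last first.
      by rewrite big1 // => mu _; rewrite mul0r mcoeff0 scale0r.
    rewrite (bigD1 (BMultinom hN)) //= big1 ?addr0 => [|mu ne]; last first.
      rewrite mul1r mcoeffX; case: eqP => [e|]; last by rewrite scale0r.
      by case/eqP: ne; apply: val_inj.
    by rewrite mul1r mcoeffX eqxx scale1r.
  have hN l : (mdeg (nu + U_(l)) < N)%N by rewrite mdegD mdeg1 addn1.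
  transitivity (\sum_l
     (\sum_(mu : 'X_{1..m < N})
        ((l == i)%:R * 'X_[K, nu + U_(j)])@_mu *: regular_comm l mu
      - \sum_(mu : 'X_{1..m < N})
        ((l == j)%:R * 'X_[K, nu + U_(i)])@_mu *: regular_comm l mu)).
    under eq_bigr => l _ do rewrite !hsum //.
    rewrite sumrB -!big_mkcond /= !big_pred1_eq; exact: act_regular.
  apply: eq_bigr => l _; rewrite -sumrB; apply: eq_bigr => mu _.
  by rewrite eps_act_br mcoeffB scalerBl.
Qed.

(** When [i = p] the commutator is zero and the two terms cancel; otherwise its image is a_i t^mu -
    a_p t^mu t_i / t_p. *)
Lemma eps_regular_comm i mu l : mu != 0%MM ->
  let p := least_index (mu + U_(i))%MM in
  (eps (regular_comm i mu)).1 l =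
  (l == i)%:R * 'X_[mu] - (l == p)%:R * 'X_[mu + U_(i) - U_(p)].
Proof.
move=> nz p; rewrite /regular_comm (negPf nz) -/p eps_act_br.
have /least_indexP[hp _] : (mu + U_(i))%MM != 0%MM by rewrite mnmD_eq0 (negPf nz).
have [e|ne] := eqVneq i p; first by rewrite -e addmK !subrr.
have hmu : mu p != 0%N by move: hp; rewrite -/p mnmDE mnm1E (negPf ne) addn0.
by rewrite mnm_subK // addmC addmBA ?lep1mP // addmC.
Qed.

(** The relation that cuts out the image of [eps]. On a bracket both sides are zero, since the two
    linear forms commute. *)
Lemma eps_wact x k : homogF k x -> \sum_i 'X_i * (eps x).1 i = wact (eps x).2.
Proof.
elim=> {k x} [i|j k x z _ IHx _ IHz|k|k a x z _ IHx _ IHz].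
- rewrite eps_gen wact_gen (bigD1 i) //= ffunE eqxx mulr1 big1 ?addr0 // => j ne.
  by rewrite ffunE (negPf ne) mulr0.
- rewrite epsB /= wact0; under eq_bigr => i _ do rewrite ffunE mulrBr !mulrA.
  by rewrite sumrB -!mulr_suml IHx IHz mulrC subrr.
- by rewrite eps0 /= wact0 big1 // => i _; rewrite ffunE mulr0.
- rewrite epsP /= wactD wactZ -IHx -IHz scaler_sumr -big_split.
  by apply: eq_bigr => i _ /=; rewrite !ffunE mulrDr scalerAr.
Qed.

(** One generator is split off from [y_i, y_j] t^nu: a variable of t^nu, or y_j itself when nu = 0.
    The degree of the [g j] is recorded so that they can be assembled into series. *)
Lemma homogF_br_gen k x : homogF k x -> exists g : 'I_m -> F,
  (forall j, homogF k.-1 (g j)) /\ (k != 1%N -> x = \sum_j [lie g j, y j]).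
Proof.
move/homogF_regular; elim=> {k x} [i|nu i j|k|k a x z _ [g1 [h1 e1]] _ [g2 [h2 e2]]].
- by exists (fun=> 0); split=> [j|//]; apply: homogF0.
- have hg l (w : F) : homogF (mdeg nu).+1 w -> exists g : 'I_m -> F,
      (forall j, homogF (mdeg nu).+1 (g j)) /\ [lie w, y l] = \sum_j [lie g j, y j].
    move=> hw; exists (fun k => if k == l then w else 0); split=> [k|].
      by case: ifP => _ //; apply: homogF0.
    rewrite (bigD1 l) //= eqxx big1 ?addr0 // => k ne.
    by rewrite (negPf ne) lie0x.
  suff [l [w [hw ->]]] : exists l w, homogF (mdeg nu).+1 w /\ act nu [lie y i, y j] = [lie w, y l].
    by have [g [h1 h2]] := hg l w hw; exists g.
  have [->|nz] := eqVneq nu 0%MM.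
    by exists j, (y i); rewrite act0 mdeg0; split=> //; apply: homogF_gen.
  have [hl _] := least_indexP nz; set l := least_index nu in hl.
  exists l, (act (nu - U_(l))%MM [lie y i, y j]); split.
    rewrite -(mdeg_subU hl) -add2n; apply: homogF_act; first exact: centralises_br.
    by apply: (homogF_br (homogF_gen _ _) (homogF_gen _ _)).
  by rewrite -{1}(mnm_subK hl) actU //; apply: centralises_br.
- by exists (fun=> 0); split=> [j|_]; [apply: homogF0|rewrite big1 // => j _; rewrite lie0x].
- exists (fun j => a *: g1 j + g2 j); split=> [j|ne]; first exact: homogF_lin.
  rewrite (e1 ne) (e2 ne) scaler_sumr -big_split; apply: eq_bigr => j _ /=.
  by rewrite lieDl lieZl.
Qed.

End Metabelian.

(** * The completion and its inner automorphisms *)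

Section Completion.
Variables (K : fieldType) (n : nat).
Local Notation m := n.+1.
Local Notation hF := (hatF K m).
Local Notation S := (mseries K m).
Local Notation t := (@mseries_var K m).
Local Notation D := (@hpartial K m).
Implicit Types (u v w : hF) (mu nu : 'X_{1..m}).

Lemma hpartialP i (a : K) v w : D i (a *: v + w) = a *: D i v + D i w.
Proof.
apply: mserP => mu; rewrite mserD mserZ /hpartial hcompD hcompZ epsP.
by rewrite ffunE ffunE mcoeffD mcoeffZ.
Qed.

Lemma hpartialD i v w : D i (v + w) = D i v + D i w.
Proof. by rewrite -[v]scale1r hpartialP !scale1r. Qed.

Lemma hpartial0 i : D i 0 = 0.
Proof. by apply: (addrI (D i 0)); rewrite -hpartialD !addr0. Qed.

Lemma hpartialZ i (a : K) v : D i (a *: v) = a *: D i v.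
Proof. by rewrite -[a *: v]addr0 hpartialP hpartial0 addr0. Qed.

Lemma hpartialN i v : D i (- v) = - D i v.
Proof. by rewrite -scaleN1r hpartialZ scaleN1r. Qed.

Lemma hpartialB i v w : D i (v - w) = D i v - D i w.
Proof. by rewrite hpartialD hpartialN. Qed.

Lemma hpartial_sum i I (r : seq I) (P : pred I) (G : I -> hF) :
  D i (\sum_(j <- r | P j) G j) = \sum_(j <- r | P j) D i (G j).
Proof. exact: (big_morph _ (hpartialD i) (hpartial0 i)). Qed.

Lemma hpartial_gen i j : D i (hgen K j) = (i == j)%:R.
Proof.
apply: mserP => mu; rewrite /hpartial /= eqSS mdeg_eq0.
rewrite mser_bool andbC; case: eqP => [->|ne] /=; last by rewrite eps0 ffunE mcoeff0.
by rewrite eps_gen ffunE; case: (i == j); rewrite ?mcoeff1 ?mcoeff0 ?eqxx.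
Qed.

(** The component of degree d is determined by its coordinates in regular commutators; by
    [eps_homogF] only coefficients of degree d - 1 can be nonzero. *)
Lemma hcomp_inj_hpartial v w d :
  (forall i mu, (mdeg mu).+1 = d -> D i v mu = D i w mu) -> v d = w d.
Proof.
move=> h; rewrite (regular_comm_expansion (leqnn d) (hatF_homog v d)).
rewrite (regular_comm_expansion (leqnn d) (hatF_homog w d)).
apply: eq_bigr => i _; apply: eq_bigr => mu _; congr (_ *: _).
have [e|ne] := eqVneq (mdeg mu).+1 d; last first.
  have [_ ->] := eps_homogF (hatF_homog v d) => //.
  by have [_ ->] := eps_homogF (hatF_homog w d).
by have := h i mu e; rewrite /hpartial e.
Qed.

Lemma hpartial_inj v w : (forall i, D i v = D i w) -> v = w.
Proof. by move=> h; apply: hatFP => d; apply: hcomp_inj_hpartial => i mu _; rewrite h. Qed.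

(* The linear part \sum_j beta_j b_j of eps v, as the form \sum_j beta_j t_j
   by which the bracket with v acts on C_m. *)
Definition lin_part v : S := \sum_i t i * D i v.

(** This is [eps_wact] in each degree: multiplication by t_i makes up for the drop of degree in
    [hpartial]. *)
Lemma lin_partE v mu : lin_part v mu = (wact (eps (v (mdeg mu))).2)@_mu.
Proof.
rewrite -(eps_wact (hatF_homog v _)) /lin_part mser_sum raddf_sum /=; apply: eq_bigr => i _.
rewrite mser_varM; case: ifPn => [h|].
  rewrite /hpartial mdeg_subU //; set P := (eps _).1 i.
  by rewrite [in RHS]mulrC -[in RHS](mnm_subK h) addmC mcoeffMX.
rewrite negbK => /eqP h; rewrite mcoeffM big1 // => -[k1 k2] /= /eqP.
move: (k1 : 'X_{1..m}) (k2 : 'X_{1..m}) => {}k1 {}k2 e.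
rewrite mcoeffX; case: eqP => [e1|]; last by rewrite mul0r.
by move: h; rewrite e -e1 mnmDE mnm1E eqxx.
Qed.

Lemma lin_part_homog v : homog_ser 1 (lin_part v).
Proof.
move=> mu h; rewrite lin_partE.
by have [->] := eps_homogF (hatF_homog v (mdeg mu)) => //; rewrite wact0 mcoeff0.
Qed.

Lemma lin_partU v i : lin_part v U_(i)%MM = D i v 0%MM.
Proof. exact: mser_sum_varU. Qed.

Lemma lin_part_inj v w : (forall i, D i v 0%MM = D i w 0%MM) -> lin_part v = lin_part w.
Proof.
move=> h; rewrite [LHS]homog1_lin_form; last exact: lin_part_homog.
rewrite [RHS]homog1_lin_form; last exact: lin_part_homog.
by apply: eq_bigr => i _; rewrite !lin_partU h.
Qed.

(** The series [v] has the f_i as coefficients on the regular commutators. Its l-th derivative is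
    f_l minus the corrections from the second term of [eps_regular_comm], which add up to a
    coefficient of sum_i t_i f_i in degree at least 2, hence to zero. *)
Lemma hpartial_ext (f : 'I_m -> S) : homog_ser 1 (\sum_i t i * f i) ->
  exists v, forall i, D i v = f i.
Proof.
move=> hf.
pose vd d : FreeMetab K m := \sum_i
  \sum_(mu : 'X_{1..m < d} | (mdeg mu).+1 == d) (f i mu : K) *: regular_comm K i mu.
have hv d : homogF d (vd d).
  apply: homogF_sum => i _; apply: homogF_sum => mu /eqP e.
  rewrite -[_ *: _]addr0; apply: homogF_lin; last exact: homogF0.
  by have := homogF_regular_comm K i mu; rewrite e.
exists (mk_hatF hv) => l; apply: mserP => mu; rewrite /hpartial /= /vd.
set d := (mdeg mu).+1; have hmu : (mdeg mu < d)%N by [].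
have hd (nu : 'X_{1..m}) : ((mdeg nu).+1 == d) = (mdeg nu == mdeg mu) by rewrite eqSS.
clearbody d.
rewrite mcoeff_eps_sum.
under eq_bigr => i _ do rewrite mcoeff_eps_sum.
under eq_bigr => i _ do under eq_bigr => nu _ do rewrite epsZ ffunE mcoeffZ.
(* Constant coefficients come from the generators alone, which carry no correction. *)
have [mu0|nz] := eqVneq mu 0%MM.
  rewrite (bigD1 l) //= [X in _ + X]big1 ?addr0 => [|i ne]; last first.
    rewrite big1 // => nu; rewrite hd mu0 mdeg0 mdeg_eq0 => /eqP ->.
    by rewrite /regular_comm eqxx eps_gen ffunE eq_sym (negPf ne) mcoeff0 mulr0.
  rewrite (bigD1 (BMultinom hmu)) /=; last by rewrite hd.
  rewrite big1 ?addr0 => [|nu].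
    by rewrite mu0 /regular_comm eqxx eps_gen ffunE eqxx mcoeff1 eqxx mulr1.
  rewrite hd => /andP[e] /eqP[]; apply: val_inj => /=.
  by move: e; rewrite mu0 mdeg0 mdeg_eq0 => /eqP.
have nzd (nu : 'X_{1..m}) : (mdeg nu).+1 == d -> nu != 0%MM.
  by rewrite hd => /eqP e; rewrite -mdeg_eq0 e mdeg_eq0.
(* When t^nu t_i = t^mu t_l, the least index [p] is that of [mu + U_(l)], so the condition [l = p]
   does not depend on [i] and [nu]. *)
have split i (nu : 'X_{1..m < d}) : (mdeg nu).+1 == d ->
  f i nu * ((eps (regular_comm K i nu)).1 l)@_mu =
    (l == i)%:R * (mu == nu :> 'X_{1..m})%:R * f i nu
    - (least_index (mu + U_(l)) == l)%:R * ((nu + U_(i) == mu + U_(l))%MM)%:R * f i nu.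
  move=> /nzd nz'; rewrite eps_regular_comm //.
  set p := least_index _; rewrite mcoeffB mulrBr; congr (_ - _).
    case: eqP => _; last by rewrite !mul0r mcoeff0 mulr0.
    by rewrite !mul1r mcoeffX mulrC eq_sym.
  have hp : (nu + U_(i))%MM p != 0%N.
    have /least_indexP[] // : (nu + U_(i))%MM != 0%MM.
    by rewrite mnmD_eq0 (negPf nz').
  rewrite mulrC; congr (_ * _); have [elp|nelp] := eqVneq l p.
    rewrite mul1r mcoeffX -(inj_eq (@addIm _ U_(l)%MM)) elp mnm_subK //.
    case: eqP => [<-|]; last by rewrite mulr0.
    by rewrite -/p eqxx mulr1.
  rewrite mul0r mcoeff0; case: ((nu + U_(i) =P mu + U_(l))%MM) => [e|]; last by rewrite mulr0.
  by rewrite -e -/p eq_sym (negPf nelp) mul0r.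
under eq_bigr => i _ do under eq_bigr => nu hnu do rewrite split //.
under eq_bigr => i _ do rewrite sumrB.
rewrite sumrB [X in _ - X](_ : _ = 0).
  rewrite subr0 (bigD1 l) //= [X in _ + X]big1 ?addr0 => [|i ne]; last first.
    by rewrite big1 // => nu _; rewrite eq_sym (negPf ne) !mul0r.
  rewrite (bigD1 (BMultinom hmu)) /=; last by rewrite hd.
  rewrite big1 ?addr0 => [|nu /andP[_ ne]].
    by rewrite !eqxx !mul1r.
  rewrite eqxx mul1r; case: eqP => [e|]; last by rewrite mul0r.
  by case/eqP: ne; apply: val_inj.
have [_|_] := eqVneq (least_index _) l; last first.
  by rewrite big1 // => i _; rewrite big1 // => nu _; rewrite !mul0r.
transitivity ((\sum_i t i * f i) (mu + U_(l))%MM); last first.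
  by apply: hf; rewrite mdegD mdeg1 addn1 eqSS mdeg_eq0 (negPf nz).
rewrite mser_sum; apply: eq_bigr => i _; rewrite mser_varM; case: ifPn => h.
  set rho := (mu + U_(l) - U_(i))%MM.
  have hr : mdeg rho = mdeg mu by apply: succn_inj; rewrite mdeg_subU // mdegD mdeg1 addn1.
  have hr' : (mdeg rho < d)%N by rewrite hr.
  rewrite (bigD1 (BMultinom hr')) /=; last by rewrite hd hr.
  rewrite mnm_subK // eqxx !mul1r big1 ?addr0 // => nu /andP[_ ne].
  rewrite mul1r; case: eqP => [e|]; last by rewrite mul0r.
  by case/eqP: ne; apply: val_inj; rewrite /= /rho -e addmK.
rewrite big1 // => nu _; rewrite mul1r; case: eqP => [e|]; last by rewrite mul0r.
by case/negP: h; rewrite -e mnmDE mnm1E eqxx addn1.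
Qed.

(** Only components of degree 1 have a part in B_m, so the convolution defining the bracket
    collapses to one term for each factor. *)
Lemma hpartial_lie i v w :
  D i [lie v, w] = D i v * lin_part w - D i w * lin_part v.
Proof.
have bar x : lin_part x = of_poly (wact (eps (x 1%N)).2).
  apply: mserP => mu; have [e|ne] := eqVneq (mdeg mu) 1%N; first by rewrite lin_partE e.
  rewrite lin_part_homog // /of_poly raddf_sum big1 //= => j _; rewrite mcoeffZ mcoeffX.
  by case: eqP => [e|]; rewrite ?mulr0 //; move: ne; rewrite -e mdeg1.
have term x z mu : (D i x * lin_part z) mu = ((eps (x (mdeg mu))).1 i * wact (eps (z 1%N)).2)@_mu.
  rewrite -[RHS]/(of_poly _ mu) of_polyM -bar mulrC [in RHS]mulrC.
  rewrite [lin_part z]homog1_lin_form; last exact: lin_part_homog.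
  rewrite !lin_formM; apply: eq_bigr => j _; rewrite !mser_varM; case: ifP => // h.
  by rewrite /hpartial mdeg_subU.
apply: mserP => mu; rewrite mserD mserN !term /hpartial /=.
set d := mdeg mu; rewrite mcoeff_eps_sum.
under eq_bigr => j _ do rewrite epsB ffunE mcoeffB.
rewrite sumrB; congr (_ - _).
  have hd : (d < d.+2)%N by rewrite ltnW.
  rewrite (bigD1 (Ordinal hd)) //= subSnn big1 ?addr0 // => j ne.
  have [->] := eps_homogF (hatF_homog w (d.+1 - j)) => [_|]; first by rewrite wact0 mulr0 mcoeff0.
  apply: contraNneq ne => e; apply/eqP/val_inj => /=.
  have le : (j <= d.+1)%N by rewrite -ltnS.
  by apply: succn_inj; rewrite -[in RHS](subnK le) e.
have hd : (1 < d.+2)%N by [].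
rewrite (bigD1 (Ordinal hd)) //= subn1 big1 ?addr0 // => j ne.
have [->] := eps_homogF (hatF_homog v j) => [_|]; first by rewrite wact0 mulr0 mcoeff0.
by apply: contraNneq ne => e; apply/eqP/val_inj.
Qed.

Lemma lin_partD v w : lin_part (v + w) = lin_part v + lin_part w.
Proof. by rewrite -big_split; apply: eq_bigr => i _; rewrite hpartialD mulrDr. Qed.
Lemma lin_partZ (a : K) v : lin_part (a *: v) = a *: lin_part v.
Proof. by rewrite scaler_sumr; apply: eq_bigr => i _; rewrite hpartialZ mserZr. Qed.
Lemma lin_part0 : lin_part 0 = 0.
Proof. by apply: (addrI (lin_part 0)); rewrite -lin_partD !addr0. Qed.
Lemma lin_part_lie v w : lin_part [lie v, w] = 0.
Proof.
rewrite /lin_part; under eq_bigr => i _ do rewrite hpartial_lie mulrBr !mulrA.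
by rewrite sumrB -!mulr_suml mulrC subrr.
Qed.
Lemma lin_part_gen j : lin_part (hgen K j) = t j.
Proof.
rewrite /lin_part (bigD1 j) //= hpartial_gen eqxx mulr1 big1 ?addr0 // => i ne.
by rewrite hpartial_gen (negPf ne) mulr0.
Qed.

Lemma hatF'P v : hatF' v <-> forall i, D i v 0%MM = 0.
Proof.
split=> [h i|h]; first by rewrite /hpartial mdeg0 h eps0 ffunE mcoeff0.
rewrite /hatF' /mkset -[RHS](hcomp0 K m 1); apply: hcomp_inj_hpartial => i mu [].
by move/eqP; rewrite mdeg_eq0 hpartial0 => /eqP ->.
Qed.

(** The sum is finite, so a Lie morphism can be applied to it term by term without an appeal to
    continuity. *)
Lemma hatF'_br v : hatF' v -> exists g : 'I_m -> hF, v = \sum_j [lie g j, hgen K j].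
Proof.
move=> hv; have /boolp.choice[G hG] d := homogF_br_gen (hatF_homog v d).
have hg j d : homogF d (G d.+1 j) by have [] := hG d.+1.
exists (fun j => mk_hatF (hg j)); apply: hatFP => -[|d].
  rewrite (homogF_deg0 (hatF_homog v 0)) hcomp_sum big1 // => j _.
  exact: (homogF_deg0 (hatF_homog _ 0)).
rewrite hcomp_sum.
transitivity (\sum_j [lie G d.+1 j, fmet_gen K j]).
  case: d => [|d]; last by have [_ ->] := hG d.+2.
  rewrite hv big1 // => j _; have [/(_ j) h _] := hG 1%N.
  by rewrite (homogF_deg0 h) lie0x.
apply: eq_bigr => j _ /=.
have hd : (d < d.+2)%N by rewrite ltnW.
rewrite (bigD1 (Ordinal hd)) //= subSnn eqxx big1 ?addr0 // => i ne.
case: eqP => [e|]; last by rewrite liex0.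
case/eqP: ne; apply/val_inj => /=.
have le : (i <= d.+1)%N by rewrite -ltnS.
by apply: succn_inj; rewrite -[in RHS](subnK le) e.
Qed.

(** * Inner automorphisms through partial derivatives *)

Lemma hpartial_iter_ad i u v k :
  D i (iter k.+1 (ad u) v) = lin_part u ^+ k * (D i v * lin_part u - D i u * lin_part v).
Proof.
elim: k => [|k IH]; first by rewrite expr0 mul1r /= /ad hpartial_lie.
(* A bracket has no linear part, so each further [ad u] just multiplies by [lin_part u]. *)
by rewrite iterS {1}/ad hpartial_lie IH iterS lin_part_lie mulr0 subr0 exprS; ring.
Qed.

(** With x = [lin_part u], the terms of index k + 1 sum to E(x) (x D_i v - D_i u [lin_part v]), and
    1 + x E(x) = e^x. *)
Lemma hpartial_exp_ad i u v : D i (exp_ad u v) =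
  exp_ser (lin_part u) * D i v - exp_quot (lin_part u) * D i u * lin_part v.
Proof.
set x := lin_part u; rewrite /exp_ser mulrDl mul1r.
have -> : D i v + x * exp_quot x * D i v - exp_quot x * D i u * lin_part v =
   D i v + exp_quot x * (D i v * x - D i u * lin_part v) by ring.
apply: mserP => mu; rewrite mserD exp_quotM; last exact: lin_part_homog.
rewrite {1}/hpartial /= mcoeff_eps_sum.
rewrite big_ord_recl; congr (_ + _); first by rewrite invr1 scale1r.
apply: eq_bigr => k _; rewrite epsZ !ffunE mcoeffZ; congr (_ * _).
by rewrite -hpartial_iter_ad.
Qed.

Lemma lin_part_exp_ad u v : lin_part (exp_ad u v) = lin_part v.
Proof.
rewrite /lin_part; under eq_bigr => i _ do rewrite hpartial_exp_ad mulrBr mulrCA !mulrA.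
rewrite sumrB -!mulr_suml.
have -> : \sum_i t i * exp_quot (lin_part u) * D i u = exp_quot (lin_part u) * lin_part u.
  by rewrite mulr_sumr; apply: eq_bigr => i _; ring.
have -> : \sum_i exp_ser (lin_part u) * t i * D i v = exp_ser (lin_part u) * lin_part v.
  by rewrite mulr_sumr; apply: eq_bigr => i _; ring.
by rewrite -/(lin_part v) /exp_ser; ring.
Qed.

Lemma exp_ad_morphism u : lie_morphism (exp_ad u).
Proof.
split=> [a v w|v w]; apply: hpartial_inj => i.
  rewrite hpartialP !hpartial_exp_ad hpartialP lin_partD lin_partZ.
  by rewrite !mulrDr !mserZr scalerBr; ring.
rewrite hpartial_lie !lin_part_exp_ad !hpartial_exp_ad hpartial_lie lin_part_lie.
by ring.
Qed.

Lemma exp_ad_continuous u : hcontinuous (exp_ad u).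
Proof.
(* [exp_ad u] is linear and does not lower the order of a series, so the same [k] serves. *)
move=> f k; exists k => g h.
have [lin _] := exp_ad_morphism u.
have -> : exp_ad u g - exp_ad u f = exp_ad u (g - f).
  by rewrite -scaleN1r addrC -lin scaleN1r addrC.
move=> d lt; rewrite /= big1 // => j _.
have -> : iter j (ad u) (g - f) d = 0.
  by apply: (ad_lower u h); apply: leq_trans lt (leq_addr _ _).
exact: scaler0.
Qed.

Lemma exp_ad0 : exp_ad (0 : hF) = id.
Proof.
apply/funext => v; apply: hpartial_inj => i; rewrite hpartial_exp_ad hpartial0.
by rewrite lin_part0 /exp_ser mul0r addr0 mulr0 mul0r subr0 mul1r.
Qed.

Hypothesis char0 : [pchar K] =i pred0.

(** The composite has derivatives e^(x+x') D_i v - (e^x' E(x) D_i u + E(x') D_i u') [lin_part v].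
    Dividing the bracketed factor by the invertible series E(x+x') gives the derivatives that [w]
    must have. *)
Lemma exp_ad_comp u' u : exists w, exp_ad u' \o exp_ad u = exp_ad w.
Proof.
set x := lin_part u; set x' := lin_part u'.
have hx : homog_ser 1 x by apply: lin_part_homog.
have hx' : homog_ser 1 x' by apply: lin_part_homog.
have [J hJ _] := mser_inv (exp_quot0 (x + x')).
pose f i := J * (exp_ser x' * exp_quot x * D i u + exp_quot x' * D i u').
(* The condition for [f] to be realised by some [w]: the sum is (e^(x+x') - 1) / E(x+x'). *)
have hf : \sum_i t i * f i = x + x'.
  transitivity (J * (exp_ser x' * exp_quot x * x + exp_quot x' * x')).
    rewrite {2}/x {2}/x' /lin_part !mulr_sumr -big_split mulr_sumr.
    by apply: eq_bigr => i _ /=; rewrite /f; ring.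
  have -> : exp_ser x' * exp_quot x * x + exp_quot x' * x' = exp_ser (x + x') - 1.
    by rewrite exp_serD // /exp_ser; ring.
  by rewrite /exp_ser addrC addKr -[RHS]mul1r -hJ; ring.
have [|w hw] := @hpartial_ext f; first by rewrite hf; apply: homog_serD.
exists w; apply/funext => v; apply: hpartial_inj => i /=.
rewrite !hpartial_exp_ad lin_part_exp_ad hw.
have -> : lin_part w = x + x' by rewrite -hf; apply: eq_bigr => j _; rewrite hw.
rewrite /f (mulrA (exp_quot _) J) hJ mul1r exp_serD // -/x -/x'.
by ring.
Qed.

(** The derivatives [f i] of the inverse's exponent solve e^(-x) E(x) D_i u + E(-x) f_i = 0. *)
Lemma exp_ad_linv u : exists u', exp_ad u' \o exp_ad u = id.
Proof.
set x := lin_part u.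
have hx : homog_ser 1 x by apply: lin_part_homog.
have hNx := homog_serN hx.
have [J hJ _] := mser_inv (exp_quot0 (- x)).
have ee : exp_ser (- x) * exp_ser x = 1.
  by rewrite -exp_serD // addNr /exp_ser mul0r addr0.
pose f i := - (J * exp_ser (- x) * exp_quot x * D i u).
have hf : \sum_i t i * f i = - x.
  transitivity (- (J * (exp_ser (- x) * (exp_quot x * x)))).
    rewrite {3}/x /lin_part !mulr_sumr -sumrN.
    by apply: eq_bigr => i _ /=; rewrite /f; ring.
  have -> : exp_quot x * x = exp_ser x - 1 by rewrite /exp_ser; ring.
  by rewrite mulrBr ee mulr1 /exp_ser -[RHS]mul1r -hJ; ring.
have [|w hw] := @hpartial_ext f; first by rewrite hf.
exists w; apply/funext => v; apply: hpartial_inj => i /=.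
rewrite !hpartial_exp_ad lin_part_exp_ad hw.
have -> : lin_part w = - x by rewrite -hf; apply: eq_bigr => j _; rewrite hw.
rewrite /f mulrN !mulrA hJ mul1r -/x mulrBr !mulrA ee mul1r.
by ring.
Qed.

Lemma exp_ad_inv u : exists u', cancel (exp_ad u) (exp_ad u') /\ cancel (exp_ad u') (exp_ad u).
Proof.
have [u' h1] := exp_ad_linv u; have [u'' h2] := exp_ad_linv u'.
have c1 : cancel (exp_ad u) (exp_ad u') by move=> v; apply: (congr1 (fun f => f v) h1).
have c2 : cancel (exp_ad u') (exp_ad u'') by move=> v; apply: (congr1 (fun f => f v) h2).
(* The left inverse has a left inverse in turn, so it is two-sided. *)
by exists u'; split=> // v; rewrite -[exp_ad u _]c2 c1 c2.
Qed.

Lemma exp_ad_aut u : continuous_aut (exp_ad u).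
Proof.
have [u' [h1 h2]] := exp_ad_inv u; split; [exact: exp_ad_morphism| |exact: exp_ad_continuous].
by exists (exp_ad u').
Qed.

(** * Morphisms that are the identity modulo the commutator ideal *)

Lemma continuous_aut_comp (phi psi : hF -> hF) :
  continuous_aut phi -> continuous_aut psi -> continuous_aut (phi \o psi).
Proof.
move=> [[l1 b1] bij1 c1] [[l2 b2] bij2 c2]; split; last 2 first.
- exact: bij_comp.
- move=> f k; have [l hl] := c1 (psi f) k; have [l' hl'] := c2 f l.
  by exists l' => g /hl' /hl.
by split=> [a v w|v w] /=; rewrite ?l2 ?l1 ?b2 ?b1.
Qed.

Lemma lie_morphism0 (phi : hF -> hF) : lie_morphism phi -> phi 0 = 0.
Proof. by case=> lin _; have := lin (-1) 0 0; rewrite scaler0 addr0 scaleN1r addNr. Qed.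

Lemma lie_morphismZ (phi : hF -> hF) (a : K) v : lie_morphism phi -> phi (a *: v) = a *: phi v.
Proof.
by move=> h; have [lin _] := h; rewrite -[a *: v]addr0 lin (lie_morphism0 h) addr0.
Qed.

Lemma lie_morphism_sum (phi : hF -> hF) I (r : seq I) (G : I -> hF) : lie_morphism phi ->
  phi (\sum_(j <- r) G j) = \sum_(j <- r) phi (G j).
Proof.
move=> h; have [lin _] := h; apply: (big_morph phi _ (lie_morphism0 h)) => v w.
by rewrite -[v]scale1r lin !scale1r.
Qed.

(** Modulo a finite sum of brackets, which have no linear part before or after [phi], an element is
    a linear combination of generators. *)
Lemma lie_morphism_lin_part (phi : hF -> hF) : lie_morphism phi ->
  (forall j, lin_part (phi (hgen K j)) = t j) -> forall v, lin_part (phi v) = lin_part v.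
Proof.
move=> hphi hg v; have [lin br] := hphi.
pose v1 : hF := \sum_j (D j v 0%MM : K) *: hgen K j.
have hv1 : lin_part v1 = lin_part v.
  apply: lin_part_inj => i; rewrite hpartial_sum mser_sum (bigD1 i) //=.
  rewrite hpartialZ mserZ hpartial_gen mser_bool !eqxx mulr1 big1 ?addr0 // => j ne.
  by rewrite hpartialZ mserZ hpartial_gen mser_bool eq_sym (negPf ne) mulr0.
have [|g hg'] := @hatF'_br (v - v1).
  by apply/hatF'P => i; rewrite hpartialB mserD mserN -!lin_partU hv1 subrr.
have -> : v = 1 *: v1 + \sum_j [lie g j, hgen K j] by rewrite -hg' scale1r addrC subrK.
have ls I (r : seq I) (G : I -> hF) : lin_part (\sum_(j <- r) G j) = \sum_(j <- r) lin_part (G j).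
  exact: (big_morph lin_part lin_partD lin_part0).
rewrite lin !lin_partD !lin_partZ !(lie_morphism_sum _ _ hphi) !ls.
congr (_ *: _ + _); last by apply: eq_bigr => j _; rewrite br !lin_part_lie.
apply: eq_bigr => j _.
by rewrite (lie_morphismZ _ _ hphi) !lin_partZ hg lin_part_gen.
Qed.

Lemma hatF'_lin_part v : hatF' v <-> lin_part v = 0.
Proof.
rewrite hatF'P; split=> [h|h i]; last by rewrite -lin_partU h.
by rewrite -lin_part0; apply: lin_part_inj => i; rewrite h hpartial0.
Qed.

(** Membership in [IA] becomes the relation sum_i t_i J_ij = t_j on each Jacobian column. *)
Lemma IAP (phi : hF -> hF) : continuous_aut phi ->
  IA phi <-> forall j, lin_part (phi (hgen K j)) = t j.
Proof.
move=> aut; have lB v w : lin_part (v - w) = lin_part v - lin_part w.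
  by rewrite lin_partD -scaleN1r lin_partZ scaleN1r.
split=> [[_ h] j|h].
  have /hatF'_lin_part/eqP := h (hgen K j); rewrite lB subr_eq0 => /eqP ->.
  exact: lin_part_gen.
have [hphi _ _] := aut; split=> // f; apply/hatF'_lin_part.
by rewrite lB lie_morphism_lin_part // subrr.
Qed.

End Completion.

(** * Coset representatives *)

Section Representatives.
Variables (K : fieldType) (n : nat).
Local Notation m := n.+2.
Local Notation hF := (hatF K m).
Local Notation S := (mseries K m).
Local Notation t := (@mseries_var K m).
Local Notation D := (@hpartial K m).
Local Notation y := (@hgen K m).
Local Notation i1 := (lift ord0 ord0 : 'I_m).
Implicit Types (u : hF) (mu : 'X_{1..m}).

(** The monomials of t_i Q_i have least variable t_i, so the summands have disjoint supports. *)
Lemma triangular_sum_unique (Q : 'I_m -> S) :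
  (forall i, i != ord0 -> forall k : 'I_m, (k < i)%N -> indep_of k (Q i)) ->
  \sum_(i | i != ord0) t i * Q i = 0 -> forall i, i != ord0 -> Q i = 0.
Proof.
move=> hQ h0 i ni; apply: mserP => mu.
case: (boolP [exists k : 'I_m, (k < i)%N && (mu k != 0%N)]) => [/existsP[k /andP[lt hk]]|].
  exact: (hQ i ni k lt mu hk).
rewrite negb_exists => /forallP hmu.
have hmu0 (k : 'I_m) : (k < i)%N -> mu k = 0%N.
  by move=> lt; have := hmu k; rewrite lt negbK => /eqP.
have := congr1 (fun p : S => p (mu + U_(i))%MM) h0.
rewrite mser_sum (bigD1 i) //= mser_varMU big1 ?addr0 // => k /andP[nk ne].
rewrite mser_varM; case: ifPn => // hk.
(* For k < i the monomial lacks t_k; for k > i the monomial left over contains t_i, which Q_k does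
   not. *)
case: (ltngtP k i) => [lt|gt|e]; last by case/eqP: ne; apply: val_inj.
  by move: hk; rewrite mnmDE mnm1E (eq_sym i) (negPf ne) hmu0.
apply: (hQ k nk i gt); rewrite mnmBE mnmDE !mnm1E eqxx (negPf ne) subn0.
by rewrite addn1.
Qed.

(** The product t_i Q_i is the part of [s] on the monomials with least variable t_i. *)
Lemma triangular_sum_ex (s : S) : indep_of ord0 s -> s 0%MM = 0 ->
  exists Q : 'I_m -> S,
    [/\ forall i, i != ord0 -> forall k : 'I_m, (k < i)%N -> indep_of k (Q i),
        \sum_(i | i != ord0) t i * Q i = s &
        forall i, Q i 0%MM = s U_(i)%MM].
Proof.
move=> hs s0.
pose Q (i : 'I_m) : S := fun mu =>
  if [forall k : 'I_m, (k < i)%N ==> (mu k == 0%N)] then s (mu + U_(i))%MM else 0.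
exists Q; split=> [i ni k lt mu hk||i].
- by rewrite /Q; case: ifP => // /forallP/(_ k); rewrite lt (negPf hk).
- apply: mserP => mu; rewrite mser_sum; have [->|nz] := eqVneq mu 0%MM.
    by rewrite s0 big1 // => i _; rewrite mser_var0.
  have [hp hmin] := least_indexP nz; set p := least_index mu in hp hmin.
  have term i : i != p -> (t i * Q i) mu = 0.
    move=> ne; rewrite mser_varM /Q; case: ifPn => // hi; case: ifP => // /forallP h.
    case/eqP: ne; apply: esym; apply: least_index_eq => // k lt.
    have /implyP/(_ lt)/eqP := h k; rewrite mnmBE mnm1E.
    by case: eqP lt => [->|_]; rewrite ?ltnn // subn0.
  have [p0|np] := eqVneq p ord0.
    by rewrite (hs mu) -?p0 // big1 // => i ni; apply: term.
  rewrite (bigD1 p) //= big1 ?addr0 => [|i /andP[_]]; last exact: term.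
  rewrite mser_varM hp /Q mnm_subK //; case: ifP => // /negP[]; apply/forallP => k.
  by apply/implyP => /hmin h; rewrite mnmBE h.
- by rewrite /Q add0m; case: ifP => // /negP[]; apply/forallP => k; rewrite mnm0E implybT.
Qed.

Lemma Theta_normal_form (theta : hF -> hF) : Theta theta <->
  continuous_aut theta /\ exists s q r f, theta_conditions s q r f /\
    forall i j, D i (theta (y j)) = (i == j)%:R + theta_matrix s q r f i j.
Proof.
split=> -[aut [s [q [r [f [hc h]]]]]]; split=> //; exists s, q, r, f; split=> //.
  by move=> i j; have /matrixP/(_ i j) := h; rewrite !mxE.
by apply/matrixP => i j; rewrite !mxE h mxE.
Qed.

(** For the first column the sum is t_1 (s + sum_i t_i q_i) + sum_i t_i r_i. *)
Lemma theta_matrix_syzygy (s : S) q r f j : theta_conditions s q r f ->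
  \sum_i t i * theta_matrix s q r f i j = 0.
Proof.
move=> [_ [hs hr hf] _ _]; have [->|nj] := eqVneq j ord0; last first.
  rewrite -[RHS](hf j nj); apply: eq_bigr => i _.
  by rewrite mxE (negPf nj).
rewrite (bigD1 ord0) //= mxE !eqxx.
rewrite (eq_bigr (fun i => t ord0 * (t i * q i) + t i * r i)) => [|i ni].
  transitivity (t ord0 * (s + \sum_(i | i != ord0) t i * q i) + \sum_(i | i != ord0) t i * r i).
    by rewrite big_split /= -mulr_sumr mulrDr addrA.
  by rewrite hs hr mulr0 addr0.
by rewrite mxE eqxx (negPf ni); ring.
Qed.

Lemma sum_delta_syzygy (g : 'I_m -> S) j : \sum_i t i * g i = 0 ->
  \sum_i t i * ((i == j)%:R + g i) = t j.
Proof.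
move=> h; under eq_bigr => i _ do rewrite mulrDr.
rewrite big_split /= h addr0 (bigD1 j) //= eqxx mulr1 big1 ?addr0 // => i ne.
by rewrite (negPf ne) mulr0.
Qed.

Lemma Theta_IA (theta : hF -> hF) : Theta theta -> IA theta.
Proof.
move=> /Theta_normal_form[aut [s [q [r [f [hc h]]]]]]; apply/IAP => // j.
rewrite /lin_part; under eq_bigr => i _ do rewrite h.
by apply/sum_delta_syzygy/theta_matrix_syzygy.
Qed.

Lemma IA_lin_part (phi : hF -> hF) j : IA phi -> lin_part (phi (y j)) = t j.
Proof. by move=> h; apply: (IAP h.1).1. Qed.

Lemma IA_hpartial0 (phi : hF -> hF) i j : IA phi -> D i (phi (y j)) 0%MM = (i == j)%:R.
Proof.
by move=> h; rewrite -lin_partU IA_lin_part // /mseries_var eq_mnm1.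
Qed.

Hypothesis char0 : [pchar K] =i pred0.

(** It is enough that u = u'. Linear coefficients of the Jacobians first identify the linear parts
    of u and u'; the shape of the first column then identifies all derivatives. *)
Lemma Inn_Theta_inj u u' (theta theta' : hF -> hF) : Theta theta -> Theta theta' ->
  exp_ad u \o theta = exp_ad u' \o theta' -> theta = theta'.
Proof.
move=> hT hT' eq; have hIA := Theta_IA hT; have hIA' := Theta_IA hT'.
suff eu : u = u'.
  have [w [c _]] := exp_ad_inv char0 u; apply/funext => v; apply: (can_inj c).
  by have := congr1 (fun f => f v) eq; rewrite -eu.
move: hT hT' => /Theta_normal_form[_ [s [q [r [f [hc h]]]]]].
move=> /Theta_normal_form[_ [s' [q' [r' [f' [hc' h']]]]]].
have key i j : exp_ser (lin_part u) * D i (theta (y j)) - t j * (exp_quot (lin_part u) * D i u) =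
    exp_ser (lin_part u') * D i (theta' (y j)) - t j * (exp_quot (lin_part u') * D i u').
  have := congr1 (fun f => D i (f (y j))) eq; rewrite /= !hpartial_exp_ad !IA_lin_part //.
  by rewrite ![t j * _]mulrC.
have s_lin z (ss : S) qq rr ff k : theta_conditions ss qq rr ff -> k != ord0 ->
    exp_ser (lin_part z) U_(k)%MM = D k z 0%MM /\ ss U_(k)%MM = 0.
  move=> [[_ h0 _] [hs _ _] _ _] nk; split.
    by rewrite exp_ser_U ?lin_partU //; apply: lin_part_homog.
  have := congr1 (fun p : S => p U_(k)%MM) hs.
  by rewrite mserD mser_sum_cond_varU nk (h0 k nk).1 addr0.
(* The linear part of [z] is read off from entries (1,1) and (1,2): [s] has no term in t_k for k >
   1, the q_k having no constant term, and f_12 has no term in t_2. *)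
have lin_coef z (ss : S) qq rr ff (th : hF -> hF) : IA th -> theta_conditions ss qq rr ff ->
    (forall i j, D i (th (y j)) = (i == j)%:R + theta_matrix ss qq rr ff i j) ->
    (forall k, k != ord0 -> (exp_ser (lin_part z) * D ord0 (th (y ord0)) -
        t ord0 * (exp_quot (lin_part z) * D ord0 z)) U_(k)%MM = D k z 0%MM) /\
    (exp_ser (lin_part z) * D ord0 (th (y i1)) -
        t i1 * (exp_quot (lin_part z) * D ord0 z)) U_(i1)%MM = - D ord0 z 0%MM.
  move=> hth cc hh; have hz := lin_part_homog z; split=> [k nk|].
    have [e1 e2] := s_lin z _ _ _ _ k cc nk.
    rewrite mserD mserN mserMU mser_varU eq_sym (negPf nk) subr0 IA_hpartial0 // eqxx.
    rewrite exp_ser0 // mul1r mulr1 e1 hh mxE !eqxx mserD mser_bool e2 -mdeg_eq0 mdeg1.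
    by rewrite !add0r.
  have [_ _ _ f0] := cc.
  rewrite mserD mserN mserMU mser_varU eqxx IA_hpartial0 // mulr0 addr0.
  rewrite exp_ser0 // mul1r hh mserD mser_bool mxE /= f0 !add0r.
  by rewrite mserM0 exp_quot0 // mul1r.
have [a1 a2] := lin_coef u _ _ _ _ theta hIA hc h.
have [a1' a2'] := lin_coef u' _ _ _ _ theta' hIA' hc' h'.
have ebar : lin_part u = lin_part u'.
  apply: lin_part_inj => k; have [->|nk] := eqVneq k ord0.
    by apply: oppr_inj; rewrite -a2 -a2' key.
  by rewrite -a1 // -a1' // key.
have hx := lin_part_homog u.
have [I hI _] := mser_inv (exp_ser0 hx); have [J hJ _] := mser_inv (exp_quot0 (lin_part u)).
(* Dividing [key] by e^x shows that t_1 d_i is the difference of the first columns. *)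
pose d i := I * exp_quot (lin_part u) * (D i u - D i u').
have hd i : t ord0 * d i = theta_matrix s q r f i ord0 - theta_matrix s' q' r' f' i ord0.
  have /eqP := key i ord0; rewrite -ebar h h' -subr_eq0 => /eqP k0.
  apply/eqP; rewrite -subr_eq0; apply/eqP.
  transitivity (- (I * 0 : S)); last by rewrite mulr0 oppr0.
  rewrite -k0 /d; set A := theta_matrix _ _ _ _ i _; set B := theta_matrix _ _ _ _ i _.
  transitivity (t ord0 * (I * exp_quot (lin_part u) * (D i u - D i u')) -
     (exp_ser (lin_part u) * I) * (A - B)); last by ring.
  by rewrite hI mul1r.
have [_ [hs hr _] [is_ ir iq] _] := hc; have [_ [hs' hr' _] [is_' ir' iq'] _] := hc'.
have hU mu : (mu + U_(ord0))%MM ord0 != 0%N by rewrite mnmDE mnm1E eqxx addn1.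
(* The first row, s - s', is free of t_1, yet divisible by it. *)
have d0 : d ord0 = 0.
  apply: mserP => mu; rewrite -(mser_varMU ord0) hd !mxE eqxx mserD mserN is_ ?is_' ?subr0 //.
have di i : i != ord0 -> d i = q i - q' i.
  move=> ni; apply: mserP => mu; rewrite -(mser_varMU ord0) hd !mxE eqxx (negPf ni).
  rewrite mserD mserN !mserD !mser_varMU ir ?ir' // ?hU // !addr0 //.
have ess : s = s'.
  by have := hd ord0; rewrite d0 mulr0 !mxE eqxx => /esym/eqP; rewrite subr_eq0 => /eqP.
(* Since s = s', the sum of the t_i (q_i - q'_i) is zero and triangular uniqueness applies. *)
have d_eq0 i : d i = 0.
  have [->//|ni] := eqVneq i ord0; rewrite di //.
  apply: (triangular_sum_unique (Q := fun i => q i - q' i)) ni => [k nk l lt mu hl|].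
    by rewrite mserD mserN (iq k nk l lt) // (iq' k nk l lt) // subr0.
  under eq_bigr => k _ do rewrite mulrBr.
  rewrite sumrB; apply: (addrI s); rewrite addr0 addrA hs ess sub0r.
  by apply/eqP; rewrite eq_sym -addr_eq0 hs'.
apply: hpartial_inj => i; apply/eqP; rewrite -subr_eq0; apply/eqP.
transitivity (exp_ser (lin_part u) * J * d i); last by rewrite d_eq0 mulr0.
transitivity ((exp_ser (lin_part u) * I) * (exp_quot (lin_part u) * J) * (D i u - D i u')).
  by rewrite hI hJ !mul1r.
by rewrite /d; ring.
Qed.

(** The derivatives of [u] are built as g_i = b_i + w_i / E(x): the constants b_i remove the
    forbidden linear terms, and the w_i then bring the first column to normal form. *)
Lemma Inn_Theta_ex (phi : hF -> hF) : IA phi -> exists u, Theta (exp_ad u \o phi).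
Proof.
move=> hphi.
pose M i j : S := D i (phi (y j)) - (i == j)%:R.
have ME i j : D i (phi (y j)) = (i == j)%:R + M i j by rewrite addrC subrK.
have M0 i j : M i j 0%MM = 0.
  by rewrite /M mserD mserN IA_hpartial0 // mser_bool eqxx andbT subrr.
(* b_1 cancels the coefficient of t_2 in entry (1,2), and b_k for k > 1 that of t_k in entry
   (1,1). *)
pose b k : K := if k == ord0 then M ord0 i1 U_(i1)%MM else - M ord0 ord0 U_(k)%MM.
pose x : S := lin_form b; pose e := exp_ser x; pose E := exp_quot x.
have hx : homog_ser 1 x := lin_form_homog b.
have [J hJ _] := mser_inv (exp_quot0 x); rewrite -/E in hJ.
have e0 : e 0%MM = 1 := exp_ser0 hx.
have E0 : E 0%MM = 1 := exp_quot0 x.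
have sumM j : \sum_i t i * M i j = 0.
  under eq_bigr => i _ do rewrite mulrBr.
  rewrite sumrB -/(lin_part _) IA_lin_part // (bigD1 j) //= eqxx mulr1 big1 ?addr0 ?subrr // => i ne.
  by rewrite (negPf ne) mulr0.
pose bs k : S := b k *: (1 : S).
have bs0 k : bs k 0%MM = b k by rewrite /bs mserZ mser1 eqxx mulr1.
have sumb : \sum_i t i * bs i = x.
  by apply: eq_bigr => i _; rewrite /bs mserZr mulr1.
(* The first column, minus that of the identity, if the g_i were just the b_i; the actual one is N_i
   - t_1 w_i. *)
pose N i : S := e * ((i == ord0)%:R + M i ord0) - t ord0 * (E * bs i) - (i == ord0)%:R.
have sumN : \sum_i t i * N i = 0.
  transitivity (e * (\sum_i t i * ((i == ord0)%:R + M i ord0)) - t ord0 * E * (\sum_i t i * bs i)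
    - \sum_i t i * ((i == ord0)%:R + 0)).
    rewrite !mulr_sumr -!sumrB; apply: eq_bigr => i _; rewrite /N; ring.
  rewrite !sum_delta_syzygy // ?sumb; first by rewrite /e /exp_ser -/E; ring.
  by rewrite big1 // => i _; rewrite mulr0.
have N0 i : N i 0%MM = 0.
  by rewrite /N !mserD !mserN mser_var0 subr0 mserM0 e0 mul1r mserD M0 addr0 subrr.
have NU k : k != ord0 -> N ord0 U_(k)%MM = 0.
  move=> nk; rewrite /N !mserD !mserN mser_varU eq_sym (negPf nk) subr0 mserMU e0 mul1r !mserD.
  have Uk0 : (U_(k)%MM == 0%MM :> 'X_{1..m}) = false by rewrite -mdeg_eq0 mdeg1.
  rewrite M0 !mser_bool Uk0 !eqxx /= add0r subr0 addr0 mulr1.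
  by rewrite /e exp_ser_U // /x lin_form_U /b (negPf nk) subrr.
pose s : S := fun mu => if mu ord0 == 0%N then N ord0 mu else 0.
pose r i : S := fun mu => if mu ord0 == 0%N then N i mu else 0.
pose N' i : S := fun mu => N i (mu + U_(ord0))%MM.
have NE i : N i = r i + t ord0 * N' i.
  apply: mserP => mu; rewrite mserD mser_varM /r; have [z|nz] := eqVneq (mu ord0) 0%N.
    by rewrite addr0.
  by rewrite add0r /N' mnm_subK.
have ind i : indep_of ord0 (r i) by move=> mu /negPf h; rewrite /r h.
have s0 : (- s) 0%MM = 0 by rewrite mserN /s N0 if_same oppr0.
(* By [q0] the constant term of q_i is minus the coefficient of t_i in s, which [NU] makes zero. *)
have [|q [iq sumq q0]] := @triangular_sum_ex (- s) _ s0.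
  by move=> mu h; rewrite mserN [s mu](ind ord0 mu h) oppr0.
(* This is the part of [sumN] free of t_1. *)
have sumr_ : \sum_(i | i != ord0) t i * r i = 0.
  apply: mserP => mu; rewrite mser_sum; have [z|nz] := eqVneq (mu ord0) 0%N.
    have := congr1 (fun p : S => p mu) sumN; rewrite mser_sum (bigD1 ord0) //= mser_varM z /= add0r.
    move=> h; rewrite -[RHS]h; apply: eq_bigr => i ni; rewrite !mser_varM; case: ifP => // _.
    by rewrite /r mnmBE z sub0n.
  rewrite big1 // => i ni; rewrite mser_varM; case: ifP => // _.
  by apply: ind; rewrite mnmBE mnm1E (negPf ni) subn0.
(* Subtracting t_1 w_i from N_i = r_i + t_1 N'_i leaves s in the first row and t_1 q_i + r_i
   below. *)
pose w i := N' i - (if i == ord0 then 0 else q i).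
have sumw : \sum_i t i * w i = 0.
  (* The relation is checked after multiplication by t_1, which is not a zero divisor. *)
  apply: (@mser_var_inj _ _ ord0).
  transitivity (\sum_i t i * N i - \sum_(i | i != ord0) t i * r i
     - t ord0 * (s + \sum_(i | i != ord0) t i * q i)); last first.
    by rewrite sumN sumr_ sumq !subrr mulr0 subr0.
  rewrite (bigD1 ord0) //= [in RHS](bigD1 ord0) //= mulrDr mulr_sumr.
  rewrite (eq_bigr (fun i => t i * N i - t i * r i - t ord0 * (t i * q i))) => [|i ni].
    rewrite !sumrB -mulr_sumr {1}NE -[s]/(r ord0) /w eqxx; ring.
  by rewrite /w (negPf ni) NE; ring.
pose g i := bs i + J * w i.
have sumg : \sum_i t i * g i = x.
  transitivity (\sum_i t i * bs i + J * \sum_i t i * w i); last by rewrite sumw mulr0 addr0.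
  by rewrite mulr_sumr -big_split; apply: eq_bigr => i _; rewrite /g /=; ring.
have [|u hu] := @hpartial_ext _ _ g; first by rewrite sumg.
have ux : lin_part u = x by rewrite -sumg; apply: eq_bigr => i _; rewrite hu.
exists u; apply/Theta_normal_form; split.
  by apply: continuous_aut_comp hphi.1; apply: exp_ad_aut.
pose f i j : S := e * ((i == j)%:R + M i j) - t j * (E * g i) - (i == j)%:R.
(* So g_1 has constant term b_1, as the condition on f_12 requires. *)
have w0 i : w i 0%MM = 0 by rewrite -mser_sum_varU sumw.
have Jac i j : D i ((exp_ad u \o phi) (y j)) = (i == j)%:R + f i j.
  by rewrite /= hpartial_exp_ad IA_lin_part // ux hu ME /f -/e -/E; ring.
have f0 i j : f i j 0%MM = 0.
  by rewrite /f !mserD !mserN mser_var0 subr0 mserM0 e0 mul1r mserD M0 addr0 subrr.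
exists s, q, r, f; split; last first.
  move=> i j; rewrite Jac; congr (_ + _); rewrite mxE; case: eqP => // ->.
  have -> : f i ord0 = N i - t ord0 * w i.
    transitivity (N i - t ord0 * ((E * J) * w i)); last by rewrite hJ mul1r.
    by rewrite /f /N /g; ring.
  rewrite NE /w; case: eqP => [->|_]; first by rewrite subr0 addrK.
  by ring.
split; [split=> [|i ni|i j nj]|split=> [||j nj]|split=> [|i ni|]|] => //.
- by rewrite /s N0 if_same.
- by rewrite q0 mserN /s mnm1E eq_sym (negPf ni) NU ?oppr0 // /r N0 if_same.
- by rewrite sumq subrr.
- transitivity (e * (\sum_i t i * ((i == j)%:R + M i j)) - t j * E * (\sum_i t i * g i)
    - \sum_i t i * ((i == j)%:R + 0)).
    rewrite !mulr_sumr -!sumrB; apply: eq_bigr => i _; rewrite /f; ring.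
  rewrite !sum_delta_syzygy // ?sumg; first by rewrite /e /exp_ser -/E; ring.
  by rewrite big1 // => i _; rewrite mulr0.
- exact: (ind ord0).
- rewrite /f !mserD !mserN mser_varU eqxx mserMU e0 mul1r !mserD !mser_bool /=.
  by rewrite !add0r M0 mulr0 addr0 mserM0 E0 mul1r /g mserD bs0 mserM0 w0 mulr0 addr0 /b eqxx subr0 subrr.
Qed.

End Representatives.

Theorem theorem6 (K : fieldType) (char0 : [pchar K]%R =i pred0) (n : nat) :
  [/\ @Theta K n `<=` @IA K n.+2,
      @IOut K n.+2 = [set Inn_coset theta | theta in @Theta K n],
      @IA K n.+2 = \bigcup_(theta in @Theta K n) Inn_coset theta,
      trivIset (@Theta K n) (@Inn_coset K n.+2) &
      forall C, @IOut K n.+2 C -> exists! theta, @Theta K n theta /\ C theta].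
Proof.
(* Closure of [Inn] under composition and inverses: cosets do not change under left multiplication
   by [Inn]. *)
have coset_exp (phi : hatF K n.+2 -> hatF K n.+2) u :
    Inn_coset (exp_ad u \o phi) = Inn_coset phi.
  apply/seteqP; split=> _ [_ [v _ <-] <-] /=.
    have [w e] := exp_ad_comp char0 v u.
    by exists (exp_ad w); [exists w|rewrite -e compA].
  have [u' [c _]] := exp_ad_inv char0 u; have [w e] := exp_ad_comp char0 v u'.
  exists (exp_ad w); first by exists w.
  by rewrite -e; apply/funext => z /=; rewrite c.
have coset_refl (phi : hatF K n.+2 -> hatF K n.+2) : Inn_coset phi phi.
  by exists id => //; exists 0 => //; apply: exp_ad0.
have IA_exp (phi : hatF K n.+2 -> hatF K n.+2) u : IA phi -> IA (exp_ad u \o phi).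
  move=> h; have aut := continuous_aut_comp (exp_ad_aut char0 u) h.1.
  by apply/(IAP aut) => j; rewrite /= lin_part_exp_ad IA_lin_part.
split.
- exact: Theta_IA.
- apply/seteqP; split=> _ [phi hphi <-]; last by exists phi => //; apply: Theta_IA.
  have [u hu] := Inn_Theta_ex char0 hphi; exists (exp_ad u \o phi) => //.
- apply/seteqP; split=> [phi hphi|_ [theta hT [_ [u _ <-] <-]]]; last first.
    exact/IA_exp/Theta_IA.
  have [u hu] := Inn_Theta_ex char0 hphi; exists (exp_ad u \o phi) => //.
  by rewrite coset_exp.
- move=> theta theta' hT hT' [_ [[_ [u _ <-] <-] [_ [u' _ <-] e]]].
  exact: (Inn_Theta_inj char0 hT hT' (esym e)).
- move=> _ [phi hphi <-]; have [u hu] := Inn_Theta_ex char0 hphi.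
  exists (exp_ad u \o phi); split; first by split=> //; exists (exp_ad u) => //; exists u.
  move=> theta [hT [_ [v _ <-] e]].
  (* Inverse inner automorphisms bring both candidates back to [phi], so injectivity identifies
     them. *)
  have [u' [c _]] := exp_ad_inv char0 u; have [v' [c' _]] := exp_ad_inv char0 v.
  apply: (Inn_Theta_inj char0 (u := u') (u' := v') hu hT).
  by rewrite -e; apply/funext => z /=; rewrite c c'.
Qed.
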